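(* Suppose that $X\sim\mathcal{N}(0,\Sigma)$ for some non-singular $\Sigma$. Then $\|\hat\beta_n\|_2=O_{\mathbb{P}}(1)$ and, as $n\to\infty$, $$\|\hat\beta_n\|_{2,\Sigma}\stackrel{\mathbb{P}}{\longrightarrow}c\qquad\text{and}\qquad\|\hat\beta_n\|_{2,\widehat\Sigma_n}\stackrel{\mathbb{P}}{\longrightarrow}c,$$ where $c=\sqrt{\beta^T\Sigma\beta}$ for any $\beta\in\mathcal{B}_0$, and $\widehat\Sigma_n$ is any consistent estimator of $\Sigma$.
   Context: Let $d\ge 1$, let $X$ be a random vector in $\mathbb{R}^d$, $\epsilon$ a real random variable (noise) with known cumulative distribution function $F^\epsilon$, independent of $X$, $\beta_0\in\mathbb{R}^d$ deterministic, and $Y$ a real random variable with $Y\stackrel{d}{=}\beta_0^TX+\epsilon$, i.e. $F^Y=F^{\beta_0^TX}\star F^\epsilon$, where $F^Z$ denotes the cumulative distribution function of $Z$ and $[F^{\beta^TX}\star F^\epsilon](y)=\int F^\epsilon(y-\beta^Tx)\,dF^X(x)$. One observes two independent samples: $Y_1,\dots,Y_n$ i.i.d. distributed as $Y$, and $X_1,\dots,X_n$ i.i.d. distributed as $X$. Let $F^Y_n(y)=n^{-1}\sum_{i=1}^n\mathbf{1}\{Y_i\le y\}$ and $$\mathbb{D}_{n,2}(\beta)=\int\Big(F^Y_n(y)-n^{-1}\sum_{i=1}^nF^\epsilon(y-\beta^TX_i)\Big)^2dF^Y_n(y).$$ The deconvolution least squares estimator (DLSE) $\hat\beta_n$ is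 any vector minimizing $\mathbb{D}_{n,2}$ over $\mathbb{R}^d$. $\mathcal{B}_0=\{\beta\in\mathbb{R}^d: F^Y=F^{\beta^TX}\star F^\epsilon\}$ is the set of all regression vectors for which the model holds. $\|\cdot\|_2$ is the Euclidean norm and, for a matrix $\Gamma$, $\|x\|_{2,\Gamma}=\sqrt{x^T\Gamma x}$. *)

(* Defs.v *)
From HB Require Import structures.
From mathcomp Require Import all_boot all_order all_algebra finmap.
From mathcomp Require Import all_classical all_reals all_analysis.
From mathcomp Require Import measurable_realfun.

Set Implicit Arguments.
Unset Strict Implicit.
Unset Printing Implicit Defensive.

Import Order.TTheory GRing.Theory Num.Def Num.Theory.
Import numFieldNormedType.Exports.

Local Open Scope classical_set_scope.
Local Open Scope ring_scope.

(* The product sigma-algebra on real matrices, generated by the entries; it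
   coincides with the Borel sigma-algebra. *)
Definition measure_matrix_display : measure_display.
Proof. exact: default_measure_display. Qed.

Section measurable_matrix.
Context {R : realType} (m n : nat).

Definition mx_cylinders : set (set 'M[R]_(m, n)) :=
  [set C | exists i j (A : set R),
     measurable A /\ C = (fun M : 'M[R]_(m, n) => M i j) @^-1` A].

Let mx_set0 : <<s mx_cylinders >> set0.
Proof. exact: sigma_algebra0. Qed.

Let mx_setC A : <<s mx_cylinders >> A -> <<s mx_cylinders >> (~` A).
Proof. exact: sigma_algebraC. Qed.

Let mx_bigcup (F : (set 'M[R]_(m, n))^nat) :
  (forall i, <<s mx_cylinders >> (F i)) -> <<s mx_cylinders >> (\bigcup_i F i).
Proof. exact: sigma_algebra_bigcup. Qed.

HB.instance Definition _ := @isMeasurable.Build measure_matrix_display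
  'M[R]_(m, n) <<s mx_cylinders >> mx_set0 mx_setC mx_bigcup.

End measurable_matrix.

Lemma measurable_mx_entry (R : realType) (m n : nat) (i : 'I_m) (j : 'I_n) :
  measurable_fun [set: 'M[R]_(m, n)] (fun M : 'M[R]_(m, n) => M i j).
Proof.
by move=> _ A mA; rewrite setTI; apply: sub_sigma_algebra; exists i, j, A.
Qed.

Lemma measurable_fun_mxP (d : measure_display) (T : measurableType d)
    (R : realType) (m n : nat) (f : T -> 'M[R]_(m, n)) :
  measurable_fun [set: T] f <->
  forall i j, measurable_fun [set: T] (fun t => f t i j).
Proof.
split=> [mf i j|mf].
  exact: (measurableT_comp (measurable_mx_entry i j) mf).
apply: (@measurability _ _ _ _ setT f (@mx_cylinders R m n)) => //.
by move=> _ [_ [i [j [A [mA ->]]]] <-]; exact: mf.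
Qed.

Section euclidean.
Context {R : realType} {d : nat}.

Definition dot (b x : 'cV[R]_d) : R := (b^T *m x) ord0 ord0.

Definition norm2 (x : 'cV[R]_d) : R := Num.sqrt (\sum_(i < d) x i ord0 ^+ 2).

(* ||x||_{2,G}; Num.sqrt is 0 on negative reals. *)
Definition wnorm2 (G : 'M[R]_d) (x : 'cV[R]_d) : R :=
  Num.sqrt ((x^T *m G *m x) ord0 ord0).

End euclidean.

Section laws.
Context {R : realType}.

Definition same_law d1 d2 d' (T1 : measurableType d1) (T2 : measurableType d2)
    (T' : measurableType d') (P1 : probability T1 R) (P2 : probability T2 R)
    (Z1 : T1 -> T') (Z2 : T2 -> T') :=
  forall A : set T', measurable A -> P1 (Z1 @^-1` A) = P2 (Z2 @^-1` A).

Definition independent_rv d d1 d2 (T : measurableType d)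
    (T1 : measurableType d1) (T2 : measurableType d2) (P : probability T R)
    (Z1 : T -> T1) (Z2 : T -> T2) :=
  forall (A : set T1) (B : set T2), measurable A -> measurable B ->
    P (Z1 @^-1` A `&` Z2 @^-1` B) = (P (Z1 @^-1` A) * P (Z2 @^-1` B))%E.

Definition sigma_rv d d' (T : measurableType d) (T' : measurableType d')
    (Z : T -> T') : set (set T) := preimage_set_system setT Z measurable.

Definition mutually_independent d (T : measurableType d) (P : probability T R)
    (I : choiceType) (F : I -> set (set T)) :=
  forall (J : {fset I}) (A : I -> set T), (forall i, i \in J -> F i (A i)) ->
    P (\bigcap_(i in [set` J]) A i) = (\prod_(i <- J) P (A i))%E.

(* The law N(m, s^2), which is the point mass at m when s = 0 (the value of
   normal_prob at s = 0 is a uniform law instead). *)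
Definition normal_law (m s : R) (A : set R) : \bar R :=
  if s == 0 then \d_m A else normal_prob m s A.

(* Z ~ N(mu, S): for all a, a^T Z has the law N(a^T mu, a^T S a), possibly
   degenerate. *)
Definition multivariate_normal d (T : measurableType d) (P : probability T R)
    (k : nat) (Z : T -> 'cV[R]_k) (mu : 'cV[R]_k) (S : 'M[R]_k) :=
  [/\ S^T = S, forall a : 'cV[R]_k, 0 <= (a^T *m S *m a) ord0 ord0 &
    forall (a : 'cV[R]_k) (A : set R), measurable A ->
      P ((fun w => dot a (Z w)) @^-1` A) = normal_law (dot a mu) (wnorm2 S a) A].

End laws.

Section asymptotics.
Context {R : realType} {d : measure_display} {T : measurableType d}.
Variable P : probability T R.

Definition cvg_in_probability (V : normedZmodType R) (Z : nat -> T -> V)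
    (l : V) :=
  forall e : R, 0 < e -> P [set w | e < `|Z n w - l|] @[n --> \oo] --> 0%E.

(* Z_n = O_P(1), as uniform tightness. *)
Definition bounded_in_probability (Z : nat -> T -> R) :=
  forall e : R, 0 < e ->
    exists M : R, forall n, (P [set w | (M < `|Z n w|)%R] <= e%:E)%E.

(* E n holds with probability tending to one; E n itself need not be
   measurable. *)
Definition with_probability_tending_to_one (E : nat -> set T) :=
  exists A : nat -> set T,
    [/\ forall n, measurable (A n), forall n, A n `<=` E n &
        P (A n) @[n --> \oo] --> 1%E].

End asymptotics.

Section deconvolution.
Context {R : realType} {k : nat}.

Definition convolved_cdf d (T : measurableType d) (P : probability T R)
    (X : {RV P >-> 'cV[R]_k}) (eps : {RV P >-> R}) (b : 'cV[R]_k) (y : R)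
    : \bar R :=
  (\int[distribution P X]_x cdf eps (y - dot b x))%E.

Definition model_vectors d (T : measurableType d) (P : probability T R)
    (X : {RV P >-> 'cV[R]_k}) (eps Y : {RV P >-> R}) : set 'cV[R]_k :=
  [set b | forall y, cdf Y y = convolved_cdf X eps b y].

(* Samples of size n are the first n terms of a sequence. *)
Definition empirical_cdf (n : nat) (ys : nat -> R) (y : R) : R :=
  n%:R^-1 * \sum_(i < n) (ys i <= y)%R%:R.

Definition empirical_measure (n : nat) (ys : nat -> R)
    : {measure set R -> \bar R} :=
  mscale (n%:R^-1)%:nng (msum (fun i => dirac (ys i)) n).

Definition dlse_criterion (Feps : R -> R) (n : nat) (xs : nat -> 'cV[R]_k)
    (ys : nat -> R) (b : 'cV[R]_k) : R :=
  \int[empirical_measure n ys]_y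
    (empirical_cdf n ys y -
       n%:R^-1 * \sum_(i < n) Feps (y - dot b (xs i))) ^+ 2.

Definition is_dlse (Feps : R -> R) (n : nat) (xs : nat -> 'cV[R]_k)
    (ys : nat -> R) (b : 'cV[R]_k) :=
  forall b' : 'cV[R]_k,
    dlse_criterion Feps n xs ys b <= dlse_criterion Feps n xs ys b'.

End deconvolution.

(* Main.v *)
(* Write G_v for the distribution function of eps + N(0, v), so that
   F^{b^T X} * F^eps = G_{q(b)} with q(b) = b^T Sigma b.

   For monotone H, the integral of (F_n - H)^2 with respect to F_n is at least
   sup (F_n - H)_+ ^ 3 / 8.  As the criterion at beta0 tends to 0 by
   Glivenko-Cantelli, its minimizer satisfies, up to o(1) and uniformly in y,
   F^Y(y) <= n^-1 sum_i F^eps (y - betahat^T X_i).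

   This one-sided inequality is enough: if G_c <= G_v + eta everywhere, then
   convolving with N(0, j |v - c|), j = 0, 1, ..., m - 1, and telescoping
   compares F^Y with a law of variance of order m, up to m eta; since such a law
   has mass bounded away from 0 on each side of any fixed point, eta cannot be
   small unless v is close to c.

   Uniformity in betahat comes from a finite net: moving b slightly only shifts
   the argument of F^eps on the event that X is bounded, and a shift of y is
   harmless in the telescoping argument.  Large betahat are excluded by applying
   the same net to the direction of betahat. *)
Require Import Defs.
From HB Require Import structures.
From mathcomp Require Import all_boot all_order all_algebra finmap.
From mathcomp Require Import all_classical all_reals all_analysis.
From mathcomp Require Import measurable_realfun.
From mathcomp Require Import ring lra.

Set Implicit Arguments.
Unset Strict Implicit.
Unset Printing Implicit Defensive.

Import Order.TTheory GRing.Theory Num.Def Num.Theory.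
Import numFieldNormedType.Exports.

Local Open Scope classical_set_scope.
Local Open Scope ring_scope.

(** * Gaussian convolution *)

(** Two obstacles shape the argument. The criterion is integrated against the empirical law of Y, so
    it sees the fitted function only at sample points: just to the left of an atom of Y, the fitted
    function can exceed F_n by the mass of that atom at no cost. Only the excess of F_n over the fit
    is therefore under control, and everything downstream has to run on a one-sided inequality.
    Moreover eps is arbitrary. Its law may have atoms and its characteristic function may vanish, so
    v is not recovered from G_v by dividing Fourier transforms. Telescoping replaces that division:
    convolution preserves inequalities, so a comparison between the variances c and v is carried
    along the arithmetic progression of step |v - c|. Once |v - c| >= r, the number m of steps that
    leads to a contradiction depends on r, c and eps but not on v. Hence eta and the admissible
    shift are uniform in v, including arbitrarily large v. *)

Section density.
Context d (T : measurableType d) (R : realType).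
Variables (mu nu : {measure set T -> \bar R}) (p : T -> R).
Hypotheses (mp : measurable_fun [set: T] p) (p_ge0 : forall x, 0 <= p x).
Hypothesis nuE : forall A, measurable A -> nu A = (\int[mu]_(x in A) (p x)%:E)%E.

Import HBNNSimple.

Let integral_nnsfun_density (f : {nnsfun T >-> R}) :
  (\int[nu]_x (f x)%:E = \int[mu]_x ((f x)%:E * (p x)%:E))%E.
Proof.
under [LHS]eq_integral do rewrite fimfunE -fsumEFin//.
rewrite [LHS]ge0_integral_fsum//; last 2 first.
  - by move=> r; exact/measurable_EFinP/measurableT_comp.
  - by move=> n x _; rewrite EFinM nnfun_muleindic_ge0.
under [RHS]eq_integral.
  move=> x xD; rewrite fimfunE -fsumEFin// muleC ge0_mule_fsumr; last first.
    by move=> r; rewrite EFinM nnfun_muleindic_ge0.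
  over.
rewrite [RHS]ge0_integral_fsum//; last 2 first.
  - move=> r; apply: emeasurable_funM; first exact/measurable_EFinP.
    by apply/measurable_EFinP/measurableT_comp.
  - move=> n x _; rewrite mule_ge0//; first by rewrite lee_fin.
    by rewrite EFinM nnfun_muleindic_ge0.
apply: eq_fsbigr => r _.
rewrite integralZl_indic_nnsfun// integral_indic// setIT nuE//.
under [RHS]eq_integral do rewrite EFinM muleCA.
have [r0|r0] := leP 0 r; last first.
  have -> : f @^-1` [set r] = set0.
    rewrite -subset0 => x /= fxr.
    by move: r0; rewrite -fxr ltNge fun_ge0.
  rewrite integral_set0 mule0; apply/esym; apply: integral0_eq => x _.
  by rewrite indicE in_set0 !mule0.
rewrite ge0_integralZl//=.
2: by apply: emeasurable_funM; exact/measurable_EFinP.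
2: by move=> x _; rewrite mule_ge0 ?lee_fin.
congr (_ * _)%E; rewrite integral_mkcond; apply: eq_integral => x _.
by rewrite patchE indicE; case: ifP => _; rewrite (mule1, mule0).
Qed.

(** Simple functions first, then monotone convergence. It turns integrals against [normal_prob] into
    Lebesgue integrals with a density. *)
Lemma ge0_integral_density (f : T -> \bar R) :
  measurable_fun [set: T] f -> (forall x, 0 <= f x)%E ->
  (\int[nu]_x f x = \int[mu]_x (f x * (p x)%:E))%E.
Proof.
move=> mf f0; pose f_ := nnsfun_approx measurableT mf.
transitivity (lim (\int[nu]_x (f_ n x)%:E @[n --> \oo])%E).
  rewrite -monotone_convergence//=.
  - apply: eq_integral => ? /[!inE] xD; apply/esym/cvg_lim => //=.
    exact: cvg_nnsfun_approx.
  - by move=> n; exact/measurable_EFinP/measurable_funTS.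
  - by move=> n ? _; rewrite lee_fin.
  - by move=> ? _ ? ? mn; rewrite lee_fin; exact/lefP/nd_nnsfun_approx.
under eq_fun do rewrite integral_nnsfun_density.
rewrite -monotone_convergence//=.
- apply: eq_integral => x /[!inE] xD; apply/cvg_lim => //=.
  by apply: cvgeZr => //; exact: cvg_nnsfun_approx.
- by move=> n; apply: emeasurable_funM; exact/measurable_EFinP.
- by move=> n x _; rewrite mule_ge0// lee_fin.
- move=> x _ a b ab; rewrite lee_wpmul2r ?lee_fin//.
  exact/lefP/nd_nnsfun_approx.
Qed.

End density.

Section lebesgue_translation.
Context (R : realType).
Local Notation mu := (@lebesgue_measure R).

Definition translate (u : R) : measurableTypeR R -> measurableTypeR R :=
  fun x => x + u.

Let measurable_translate (u : R) : measurable_fun setT (translate u).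
Proof. exact: measurable_funD. Qed.

HB.instance Definition _ (u : R) :=
  isMeasurableFun.Build _ _ _ _ (translate u) (measurable_translate u).

Lemma lebesgue_measure_translate (u : R) (A : set R) : measurable A ->
  pushforward mu (translate u) A = mu A.
Proof.
move=> mA; apply/esym/lebesgue_measure_unique => //= _ [[a b]] _ <-.
rewrite /pushforward.
have -> : translate u @^-1` `]a, b]%classic = `]a - u, b - u]%classic.
  by apply/seteqP; split=> x /=; rewrite /translate !in_itv/= ltrBlDr lerBrDr.
rewrite !lebesgue_measure_itv/= !lte_fin ltrD2r.
by rewrite -!EFinB opprB addrA subrK.
Qed.

Lemma ge0_integral_translate (u : R) (f : R -> \bar R) :
  measurable_fun [set: R] f -> (forall x, 0 <= f x)%E ->
  (\int[mu]_x f (x + u)%R = \int[mu]_x f x)%E.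
Proof.
move=> mf f0; transitivity (\int[pushforward mu (translate u)]_x f x)%E.
  by rewrite ge0_integral_pushforward.
by apply: eq_measure_integral => //= A mA _; exact: lebesgue_measure_translate.
Qed.

End lebesgue_translation.

Section centered_normal.
Context {R : realType}.
Local Notation mu := (@lebesgue_measure R).

Lemma ge0_integral_normal (m s : R) (f : R -> \bar R) :
  measurable_fun [set: R] f -> (forall x, 0 <= f x)%E ->
  (\int[normal_prob m s]_x f x = \int[mu]_x (f x * (normal_pdf m s x)%:E))%E.
Proof.
move=> mf f0.
apply: (@ge0_integral_density _ _ _ mu (normal_prob m s) (normal_pdf m s)
  (measurable_normal_pdf m s) (normal_pdf_ge0 m s) _ _ mf f0).
by move=> A mA; rewrite /normal_prob.
Qed.

(** Completing the square in u. If X = V + U with V, U independent of standard deviations a and b,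
    the joint density of (U, X) factors into the density of X and the conditional density of U given
    X = x. *)
Lemma normal_pdf_mul (a b x u : R) : 0 < a -> 0 < b ->
  normal_pdf 0 a (x - u) * normal_pdf 0 b u =
  normal_pdf 0 (Num.sqrt (a ^+ 2 + b ^+ 2)) x *
  normal_pdf (x * b ^+ 2 / (a ^+ 2 + b ^+ 2))
             (a * b / Num.sqrt (a ^+ 2 + b ^+ 2)) u.
Proof.
move=> a0 b0; set c := Num.sqrt _.
have ab0 : 0 < a ^+ 2 + b ^+ 2 by rewrite addr_gt0// exprn_gt0.
have c0 : 0 < c by rewrite sqrtr_gt0.
have c2 : c ^+ 2 = a ^+ 2 + b ^+ 2 by rewrite sqr_sqrtr// ltW.
rewrite !normal_pdfE ?gt_eqF ?divr_gt0 ?mulr_gt0//.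
rewrite mulrACA [RHS]mulrACA /normal_fun -!expRD; congr (_ * expR _); last first.
  have d2 : (a * b / c) ^+ 2 = a ^+ 2 * b ^+ 2 / (a ^+ 2 + b ^+ 2).
    by rewrite !exprMn exprVn c2.
  rewrite !subr0 d2 c2 !mulr2n.
  by field; rewrite ?gt_eqF ?addr_gt0 ?mulr_gt0 ?exprn_gt0 ?divr_gt0//.
rewrite /normal_peak -!invfM -!sqrtrM//; last 2 first.
- by rewrite mulrn_wge0// mulr_ge0 ?sqr_ge0 ?pi_ge0.
- by rewrite mulrn_wge0// mulr_ge0 ?sqr_ge0 ?pi_ge0.
congr (Num.sqrt _)^-1.
have d2 : (a * b / c) ^+ 2 = a ^+ 2 * b ^+ 2 / (a ^+ 2 + b ^+ 2).
  by rewrite !exprMn exprVn c2.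
rewrite d2 c2 !mulr2n; field.
by rewrite gt_eqF.
Qed.

(** After a translation, Tonelli makes u the inner variable; by [normal_pdf_mul] u then occurs only
    in a conditional density, of total mass 1. *)
Lemma normal_conv (a b : R) (f : R -> \bar R) : 0 < a -> 0 < b ->
  measurable_fun [set: R] f -> (forall x, 0 <= f x)%E ->
  (\int[normal_prob 0 b]_u \int[normal_prob 0 a]_x f (x + u)%R =
   \int[normal_prob 0 (Num.sqrt (a ^+ 2 + b ^+ 2))]_x f x)%E.
Proof.
move=> a0 b0 mf f0; set c := Num.sqrt _.
have mpdf m s : measurable_fun setT (fun x : R => (normal_pdf m s x)%:E).
  by apply/measurable_EFinP; exact: measurable_normal_pdf.
have pdf0 m s (x : R) : (0 <= (normal_pdf m s x)%:E)%E.
  by rewrite lee_fin normal_pdf_ge0.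
pose h (z : R * R) : \bar R := (f z.2 * (normal_pdf 0 a (z.2 - z.1))%:E
   * (normal_pdf 0 b z.1)%:E)%E.
have mh : measurable_fun setT h.
  apply: emeasurable_funM; last exact: (measurableT_comp (mpdf _ _)).
  apply: emeasurable_funM; first exact: measurableT_comp.
  by apply: (measurableT_comp (mpdf _ _)); exact: measurable_funB.
have h0 z : (0 <= h z)%E by rewrite !mule_ge0.
have -> : (\int[normal_prob 0 b]_u \int[normal_prob 0 a]_x f (x + u)%R =
  \int[mu]_u \int[mu]_x h (u, x))%E.
  have -> : (fun u => \int[normal_prob 0 a]_x f (x + u)%R)%E =
      (fun u => \int[mu]_x (f x * (normal_pdf 0 a (x - u)%R)%:E))%E.
    apply/funext => u.
    have mfu : measurable_fun [set: R] (fun x => f (x + u)%R).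
      by apply: measurableT_comp => //; exact: measurable_funD.
    apply: (etrans (ge0_integral_normal 0 a mfu (fun=> f0 _))).
    pose g (x : R) : \bar R := (f x * (normal_pdf 0 a (x - u)%R)%:E)%E.
    have mg : measurable_fun [set: R] g.
      apply: emeasurable_funM => //; apply: (measurableT_comp (mpdf _ _)).
      exact: measurable_funB.
    have g0 x : (0 <= g x)%E by rewrite mule_ge0.
    apply: (etrans _ (ge0_integral_translate u mg g0)).
    by apply: eq_integral => x _; rewrite /g addrK.
  rewrite ge0_integral_normal//.
  - apply: eq_integral => u _; rewrite -ge0_integralZr//.
    + apply: emeasurable_funM => //; apply: (measurableT_comp (mpdf _ _)).
      exact: measurable_funB.
    + by move=> x _; rewrite mule_ge0.
  - pose h' (z : R * R) : \bar R := (f z.2 * (normal_pdf 0 a (z.2 - z.1))%:E)%E.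
    apply: (@measurable_fun_fubini_tonelli_F _ _ _ _ _ mu h').
    + apply: emeasurable_funM; first exact: measurableT_comp.
      by apply: (measurableT_comp (mpdf _ _)); exact: measurable_funB.
    + by move=> z; rewrite /h' mule_ge0.
  - by move=> u; apply: integral_ge0 => x _; rewrite mule_ge0.
rewrite fubini_tonelli// ge0_integral_normal//.
apply: eq_integral => x _.
transitivity (\int[mu]_u (f x * (normal_pdf 0 c x)%:E *
   (normal_pdf (x * b ^+ 2 / (a ^+ 2 + b ^+ 2))%R (a * b / c)%R u)%:E))%E.
  apply: eq_integral => u _; rewrite /h /= -!muleA; congr (_ * _)%E.
  by rewrite -!EFinM normal_pdf_mul.
rewrite ge0_integralZl//; last exact: mule_ge0.
by rewrite integral_normal_pdf mule1.
exact: mpdf.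
Qed.

End centered_normal.

Section gaussian.
Context {R : realType}.
Local Notation mu := (@lebesgue_measure R).

(** Indexed by the variance, so that convolution adds the indices. As [Num.sqrt] is 0 on negative
    reals, every v <= 0 gives the point mass at 0. *)
Definition gaussian (v : R) : probability (measurableTypeR R) R :=
  if Num.sqrt v == 0
  then (dirac (0 : measurableTypeR R) : probability (measurableTypeR R) R)
  else (normal_prob 0 (Num.sqrt v) : probability (measurableTypeR R) R).

Lemma gaussianE (v : R) (A : set R) : gaussian v A = normal_law 0 (Num.sqrt v) A.
Proof. by rewrite /gaussian /normal_law; case: ifP. Qed.

Lemma gaussian_gt0E (v : R) : 0 < v ->
  gaussian v = (normal_prob 0 (Num.sqrt v) : probability (measurableTypeR R) R).
Proof. by move=> v0; rewrite /gaussian gt_eqF// sqrtr_gt0. Qed.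

Lemma measurable_integral_addr (m : probability (measurableTypeR R) R)
    (f : R -> \bar R) :
  measurable_fun [set: R] f -> (forall x, 0 <= f x)%E ->
  measurable_fun [set: R] (fun u => \int[m]_x f (x + u)%R)%E.
Proof.
move=> mf f0.
pose h (z : R * measurableTypeR R) := f (z.2 + z.1)%R.
apply: (@measurable_fun_fubini_tonelli_F _ _ _ _ _ m h) => [|z]; last exact: f0.
by apply: measurableT_comp => //; exact: measurable_funD.
Qed.

Lemma gaussian_conv (v w : R) (f : R -> \bar R) : 0 <= v -> 0 <= w ->
  measurable_fun [set: R] f -> (forall x, 0 <= f x)%E ->
  (\int[gaussian w]_u \int[gaussian v]_x f (x + u)%R =
   \int[gaussian (v + w)]_x f x)%E.
Proof.
move=> v0 w0 mf f0.
have [->|wn0] := eqVneq w 0.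
  rewrite addr0 [in LHS]/gaussian sqrtr0 eqxx integral_dirac//; last first.
    exact: measurable_integral_addr.
  rewrite diracT mul1e -/(gaussian v); apply: eq_integral => x _.
  by rewrite addr0.
have [->|vn0] := eqVneq v 0.
  rewrite add0r; apply: eq_integral => u _.
  rewrite /gaussian sqrtr0 eqxx integral_dirac//; last first.
    by apply: measurableT_comp => //; exact: measurable_funD.
  by rewrite diracT mul1e add0r.
have vp : 0 < v by rewrite lt0r vn0.
have wp : 0 < w by rewrite lt0r wn0.
have sv : 0 < Num.sqrt v by rewrite sqrtr_gt0.
have sw : 0 < Num.sqrt w by rewrite sqrtr_gt0.
rewrite (gaussian_gt0E vp) (gaussian_gt0E wp) (gaussian_gt0E (addr_gt0 vp wp)).
have E := normal_conv sv sw mf f0.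
rewrite (sqr_sqrtr v0) (sqr_sqrtr w0) in E.
exact: E.
Qed.

(** The standard normal density at 2: a lower bound, whatever the variance, for the mass of an
    interval one standard deviation long that lies within two standard deviations of the mean. *)
Definition gauss_tail : R := expR (- 2) / Num.sqrt (pi *+ 2).

Lemma gauss_tail_gt0 : 0 < gauss_tail.
Proof. by rewrite divr_gt0 ?expR_gt0// sqrtr_gt0 mulrn_wgt0// pi_gt0. Qed.

Lemma normal_prob_ge_tail (s a : R) : 0 < s -> `|a| <= 2 * s -> `|a + s| <= 2 * s ->
  (gauss_tail%:E <= normal_prob 0 s `]a, (a + s)%R])%E.
Proof.
move=> s0 al ar; rewrite /normal_prob.
have pl (x : R) : x \in `]a, (a + s)] ->
    expR (- 2) * normal_peak s <= normal_pdf 0 s x.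
  rewrite in_itv/= => /andP[ax xas].
  have xs : `|x| <= 2 * s.
    move: al ar; rewrite !ler_norml => /andP[? ?] /andP[? ?].
    by apply/andP; split; lra.
  rewrite normal_pdfE ?gt_eqF// mulrC ler_wpM2l ?normal_peak_ge0//.
  rewrite /normal_fun ler_expR subr0 mulNr lerN2 ler_pdivrMr; last first.
    by rewrite mulrn_wgt0// exprn_gt0.
  rewrite -real_normK ?num_real// mulr2n.
  have : `|x| ^+ 2 <= (2 * s) ^+ 2 by rewrite ler_sqr ?nnegrE ?mulr_ge0// ltW.
  by rewrite exprMn; lra.
apply: (@le_trans _ _ (\int[mu]_(x in `]a, (a + s)%R])
    (expR (- 2) * normal_peak s)%:E)%E).
  rewrite integral_cst//= lebesgue_measure_itv/= lte_fin ltrDl s0.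
  rewrite -EFinB -EFinM lee_fin addrAC subrr add0r /gauss_tail -mulrA.
  rewrite ler_wpM2l ?expR_ge0// /normal_peak -mulrnAr sqrtrM ?sqr_ge0//.
  by rewrite sqrtr_sqr gtr0_norm// invfM mulrAC mulVf ?mul1r// gt_eqF.
apply: ge0_le_integral => //=.
- by move=> x _; rewrite lee_fin mulr_ge0 ?expR_ge0 ?normal_peak_ge0.
- by apply/measurable_funTS/measurable_EFinP; exact: measurable_normal_pdf.
Qed.

Lemma gaussian_upper_tail (v : R) : 0 < v ->
  (gaussian v `]-oo, Num.sqrt v]%classic <= (1 - gauss_tail)%:E)%E.
Proof.
move=> v0; have s0 : 0 < Num.sqrt v by rewrite sqrtr_gt0.
have := @normal_prob_ge_tail (Num.sqrt v) (Num.sqrt v) s0.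
rewrite (gtr0_norm s0) (gtr0_norm (addr_gt0 s0 s0)) => tail.
have {}tail : (gauss_tail%:E <=
    gaussian v `]Num.sqrt v, (Num.sqrt v + Num.sqrt v)%R]%classic)%E.
  by rewrite gaussian_gt0E//; apply: tail; lra.
apply: (@le_trans _ _
  (gaussian v (~` `]Num.sqrt v, (Num.sqrt v + Num.sqrt v)%R]%classic))).
  apply: le_measure; rewrite ?inE//; first exact: measurableC.
  by move=> x /=; rewrite !in_itv/= => xs /andP[]; rewrite ltNge xs.
by rewrite probability_setC// EFinB leeB.
Qed.

Lemma gaussian_lower_tail (v : R) : 0 < v ->
  (gauss_tail%:E <= gaussian v `]-oo, (- Num.sqrt v)%R]%classic)%E.
Proof.
move=> v0; have s0 : 0 < Num.sqrt v by rewrite sqrtr_gt0.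
have := @normal_prob_ge_tail (Num.sqrt v) (- (2 * Num.sqrt v)) s0.
rewrite normrN (gtr0_norm (mulr_gt0 _ s0))//.
have -> : - (2 * Num.sqrt v) + Num.sqrt v = - Num.sqrt v by ring.
rewrite normrN (gtr0_norm s0) => tail.
apply: (@le_trans _ _ (gaussian v
    `](- (2 * Num.sqrt v))%R, (- Num.sqrt v)%R]%classic)).
  by rewrite gaussian_gt0E//; apply: tail; lra.
apply: le_measure; rewrite ?inE//.
by move=> x /=; rewrite !in_itv/= => /andP[].
Qed.

End gaussian.

Lemma integral_cst_probability d (T : measurableType d) (R : realType)
    (P : probability T R) (c : \bar R) : (\int[P]_x c = c)%E.
Proof.
by rewrite -[RHS]mule1 integral_cst//; congr (_ * _)%E; exact: probability_setT.
Qed.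

(** * Gaussian smoothing of a distribution function and separation of variances *)

Section smoothed.
Context {R : realType}.
Variable F : R -> \bar R.
Hypotheses (F_ge0 : forall y, (0 <= F y)%E) (F_le1 : forall y, (F y <= 1)%E).
Hypothesis F_nd : {homo F : x y / (x <= y)%R >-> (x <= y)%E}.
Hypothesis mF : measurable_fun [set: R] F.

(** This is G_v when F is the distribution function of eps. *)
Definition smoothed (v y : R) : \bar R := (\int[gaussian v]_x F (y - x)%R)%E.

Let mFsub (y : R) : measurable_fun [set: R] (fun x => F (y - x)).
Proof. by apply: measurableT_comp => //; exact: measurable_funB. Qed.

Lemma smoothed_ge0 v y : (0 <= smoothed v y)%E.
Proof. exact: integral_ge0. Qed.

Let msmoothed v y : measurable_fun [set: R] (fun u => smoothed v (y - u)).
Proof.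
have := @measurable_integral_addr R (gaussian v) (fun x => F (y - x)) (@mFsub y)
  (fun=> F_ge0 _).
congr (measurable_fun _ _); apply/funext => u; apply: eq_integral => x _.
by rewrite opprD addrA addrAC.
Qed.

Lemma smoothedD v t y : 0 <= v -> 0 <= t ->
  (smoothed (v + t) y = \int[gaussian t]_u smoothed v (y - u)%R)%E.
Proof.
move=> v0 t0; have E := gaussian_conv v0 t0 (@mFsub y) (fun=> F_ge0 _).
apply: (etrans (esym E)).
apply: eq_integral => u _; apply: eq_integral => x _.
by rewrite opprD addrA addrAC.
Qed.

Lemma le_smoothedD v w t tau eta : 0 <= v -> 0 <= w -> 0 <= t -> 0 <= eta ->
  (forall y, (smoothed v y <= smoothed w (y + tau)%R + eta%:E)%E) ->
  forall y, (smoothed (v + t) y <= smoothed (w + t) (y + tau)%R + eta%:E)%E.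
Proof.
move=> v0 w0 t0 eta0 vw y.
rewrite (smoothedD y v0 t0) (smoothedD (y + tau) w0 t0).
rewrite -[eta%:E](integral_cst_probability (gaussian t)) -ge0_integralD.
2: exact: measurableT.
2: by move=> u _; exact: smoothed_ge0.
2: exact: msmoothed.
2: by move=> u _; rewrite lee_fin.
2: exact: measurable_cst.
apply: ge0_le_integral.
- exact: measurableT.
- by move=> u _; exact: smoothed_ge0.
- exact: msmoothed.
- by apply: emeasurable_funD; [exact: msmoothed|exact: measurable_cst].
- by move=> u _; rewrite (addrAC y tau); exact: vw.
Qed.

Lemma le_smoothed_iter_up v t tau eta m : 0 <= v -> 0 <= t -> 0 <= eta ->
  (forall y, (smoothed v y <= smoothed (v + t) (y + tau)%R + eta%:E)%E) ->
  forall y, (smoothed v y <=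
    smoothed (v + t * m%:R) (y + tau * m%:R)%R + (eta * m%:R)%:E)%E.
Proof.
move=> v0 t0 eta0 H; elim: m => [|m IH] y; first by rewrite !mulr0 !addr0.
apply: (le_trans (IH y)).
have vt0 : 0 <= v + t by rewrite addr_ge0.
have tm0 : 0 <= t * m%:R by rewrite mulr_ge0.
have := @le_smoothedD v (v + t) (t * m%:R) tau eta v0 vt0 tm0 eta0 H
  (y + tau * m%:R).
move=> /(leeD2r (eta * m%:R)%:E) /le_trans; apply.
have -> : v + t + t * m%:R = v + t * m.+1%:R by rewrite -natr1; ring.
have -> : y + tau * m%:R + tau = y + tau * m.+1%:R by rewrite -natr1; ring.
rewrite -addeA -EFinD.
by have -> : eta + eta * m%:R = eta * m.+1%:R by rewrite -natr1; ring.
Qed.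

(** The chain descends from variance v + (m + 1) t and stops at v + t rather than v, because v + t
    is the fixed variance c2 when this is applied in [smoothed_separation]. *)
Lemma le_smoothed_iter_down v t tau eta m : 0 <= v -> 0 <= t -> 0 <= eta ->
  (forall y, (smoothed (v + t) y <= smoothed v (y + tau)%R + eta%:E)%E) ->
  forall y, (smoothed (v + t + t * m%:R) y <=
    smoothed (v + t) (y + tau * m%:R)%R + (eta * m%:R)%:E)%E.
Proof.
move=> v0 t0 eta0 H; elim: m => [|m IH] y; first by rewrite !mulr0 !addr0.
have vt0 : 0 <= v + t by rewrite addr_ge0.
have tm0 : 0 <= t * m.+1%:R by rewrite mulr_ge0.
have := @le_smoothedD (v + t) v (t * m.+1%:R) tau eta vt0 v0 tm0 eta0 H y.
move=> /le_trans; apply.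
have -> : v + t * m.+1%:R = v + t + t * m%:R.
  by rewrite -natr1 mulrDr mulr1 addrA addrAC.
apply: (@le_trans _ _ (smoothed (v + t) (y + tau + tau * m%:R)%R +
   (eta * m%:R)%:E + eta%:E)%E); first exact: leeD2r.
have -> : y + tau + tau * m%:R = y + tau * m.+1%:R by rewrite -natr1; ring.
rewrite -addeA -EFinD.
by have -> : eta * m%:R + eta = eta * m.+1%:R by rewrite -natr1; ring.
Qed.

(** Cut at one standard deviation: up to it F <= 1, beyond it y - x <= - L. The mass beyond the cut
    is at least [gauss_tail] for every v. *)
Lemma smoothed_ub v y L : 0 < v -> y + L <= Num.sqrt v ->
  (smoothed v y <= F (- L) + (1 - gauss_tail)%:E)%E.
Proof.
move=> v0 yL.
apply: (@le_trans _ _ (\int[gaussian v]_x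
    (F (- L)%R + (\1_(`]-oo, Num.sqrt v]%classic) x)%:E))%E).
  apply: ge0_le_integral => //.
  - exact: mFsub.
  - apply: emeasurable_funD => //; apply/measurable_EFinP.
    exact: measurable_indic.
  - move=> x _; rewrite indicE; case: (boolP (_ \in _)) => /=.
      by move=> _; rewrite (le_trans (F_le1 _))// leeDr.
    rewrite notin_setE/= in_itv/= => /negP; rewrite -ltNge => xv.
    by rewrite adde0; apply: F_nd; lra.
rewrite ge0_integralD//; last first.
  by apply/measurable_EFinP; exact: measurable_indic.
rewrite integral_cst_probability integral_indic// setIT.
by rewrite leeD2l// gaussian_upper_tail.
Qed.

Lemma smoothed_lb v y L : 0 < v -> - Num.sqrt v <= y - L ->
  (F L * gauss_tail%:E <= smoothed v y)%E.
Proof.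
move=> v0 yL.
apply: (@le_trans _ _ (F L * gaussian v `]-oo, (- Num.sqrt v)%R]%classic)%E).
  by rewrite lee_wpmul2l// gaussian_lower_tail.
apply: (@le_trans _ _ (\int[gaussian v]_x
    (F L * (\1_(`]-oo, (- Num.sqrt v)%R]%classic) x)%:E))%E).
  rewrite ge0_integralZl//; last first.
    by apply/measurable_EFinP; exact: measurable_indic.
  by rewrite integral_indic// setIT.
apply: ge0_le_integral => //.
- by move=> x _; rewrite mule_ge0.
- apply: emeasurable_funM => //; apply/measurable_EFinP.
  exact: measurable_indic.
- exact: mFsub.
- move=> x _; rewrite indicE; case: (boolP (_ \in _)) => /=.
    rewrite inE/= in_itv/= => xv; rewrite mule1; apply: F_nd; lra.
  by move=> _; rewrite mule0.
Qed.

Hypothesis F_tails : forall d, 0 < d ->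
  exists L, (F (- L)%R <= d%:E)%E /\ ((1 - d)%:E <= F L)%E.

(* Convolving the hypothesis repeatedly with N(0, |v - c2|) telescopes to an
   inequality between [smoothed c2] and a law of variance at least [r * m]. *)
Lemma smoothed_separation c2 r : 0 <= c2 -> 0 < r ->
  (forall d, 0 < d -> exists y, ((1 - d)%:E <= smoothed c2 y)%E) ->
  (forall d, 0 < d -> exists y, (smoothed c2 y <= d%:E)%E) ->
  exists eta tau, [/\ 0 < eta, 0 < tau & forall v, 0 <= v ->
    (forall y, (smoothed c2 y <= smoothed v (y + tau)%R + eta%:E)%E) ->
    `|v - c2| < r].
Proof.
move=> c20 r0 ctop cbot.
have e0 := @gauss_tail_gt0 R; set e := gauss_tail in e0 *.
have e80 : 0 < e / 8 by rewrite divr_gt0.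
have [L [FL _]] := F_tails e80.
have [L' [_ FL']] := F_tails (ltac:(lra) : 0 < 2^-1 :> R).
have [y1 cy1] := ctop _ e80.
have [y2 cy2] := cbot _ e80.
(* From standard deviation K on, [smoothed_ub] applies at y1 + 1 and [smoothed_lb] at y2 - 1; the
   offset 1 is the total shift m tau. The choice of m makes c2 + m |v - c2| at least K^2 as soon as
   |v - c2| >= r. *)
pose K := Num.max 1 (Num.max (y1 + 1 + L) (L' - y2 + 1)).
have K1 : 1 <= K by rewrite /K le_max lexx.
have K2 : y1 + 1 + L <= K by rewrite /K !le_max lexx !orbT.
have K3 : L' - y2 + 1 <= K by rewrite /K !le_max lexx !orbT.
pose m := (Num.truncn (K ^+ 2 / r)).+1.
have rm : K ^+ 2 <= r * m%:R.
  rewrite mulrC -ler_pdivrMr//; apply/ltW.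
  by have := truncnS_gt (K ^+ 2 / r).
have m0 : 0 < m%:R :> R by rewrite ltr0n.
have sqrtK t : r * m%:R <= t -> K <= Num.sqrt t /\ 0 < t.
  move=> rt; have Kt : K ^+ 2 <= t by exact: le_trans rt.
  have t0 : 0 < t by rewrite (lt_le_trans _ Kt)// exprn_gt0// (lt_le_trans _ K1).
  have K0 : 0 <= K by rewrite (le_trans _ K1).
  by split => //; rewrite -[leLHS](ger0_norm K0) -sqrtr_sqr ler_sqrt ?(ltW t0).
(* Over m steps the shifts add up to 1 and the errors to e / 8. *)
exists (e / 8 / m%:R), (m%:R^-1); split; [by rewrite divr_gt0|by rewrite invr_gt0|].
move=> v v0 H; rewrite ltNge; apply/negP => rv.
have eta0 : 0 <= e / 8 / m%:R by rewrite ltW// divr_gt0.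
have [cv|vc] := leP c2 v.
  rewrite ger0_norm ?subr_ge0// in rv.
  have vE : v = c2 + (v - c2) by rewrite addrC subrK.
  rewrite vE in H.
  have t0 : 0 <= v - c2 by rewrite subr_ge0.
  have := @le_smoothed_iter_up _ _ _ _ m c20 t0 eta0 H y1.
  rewrite mulVf ?gt_eqF// divfK ?gt_eqF// => bnd.
  have [Kv w0] : K <= Num.sqrt (c2 + (v - c2) * m%:R) /\ 0 < c2 + (v - c2) * m%:R.
    by apply: sqrtK; rewrite ler_wpDl// ler_wpM2r// ltW.
  (* At y1 the chain has left side at least 1 - e/8 and right side at most e/8 + (1 - e) + e/8. *)
  have := @smoothed_ub _ (y1 + 1) L w0 (le_trans K2 Kv).
  move=> ub; have : ((1 - e / 8)%:E <= (e / 8)%:E + (1 - e)%:E + (e / 8)%:E)%E.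
    apply: (le_trans cy1); apply: (le_trans bnd); apply: leeD => //.
    by apply: (le_trans ub); exact: leeD.
  by rewrite -!EFinD lee_fin; lra.
(* Now c2 is the larger variance: the chain starts at c2 + m (c2 - v) and ends at c2. At y2 - 1 its
   left side is at least e/2, its right side at most e/4. *)
have vc' := ltW vc.
rewrite distrC ger0_norm ?subr_ge0// in rv.
have cE : c2 = v + (c2 - v) by rewrite addrC subrK.
have t0 : 0 <= c2 - v by rewrite subr_ge0.
rewrite {1}cE in H.
have := @le_smoothed_iter_down _ _ _ _ m v0 t0 eta0 H (y2 - 1).
rewrite mulVf ?gt_eqF// divfK ?gt_eqF// subrK -cE => bnd.
have [Kv w0] : K <= Num.sqrt (c2 + (c2 - v) * m%:R) /\ 0 < c2 + (c2 - v) * m%:R.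
  by apply: sqrtK; rewrite ler_wpDl// ler_wpM2r// ltW.
have := @smoothed_lb _ (y2 - 1) L' w0 (ltac:(lra)).
move=> lb; have : ((1 - 2^-1)%:E * e%:E <= (e / 8)%:E + (e / 8)%:E)%E.
  apply: (@le_trans _ _ (F L' * e%:E)%E).
    by rewrite lee_wpmul2r// lee_fin ltW.
  apply: (le_trans lb); apply: (le_trans bnd); exact: leeD.
by rewrite -EFinM -EFinD lee_fin; lra.
Qed.

End smoothed.

(** * Weak law of large numbers and Glivenko-Cantelli *)

Section tending_to_one.
Context {R : realType} {d : measure_display} {T : measurableType d}.
Variable P : probability T R.
Local Notation whp := (with_probability_tending_to_one P).

(** Passing to measurable exceptional sets of vanishing probability makes intersections a matter of
    subadditivity. *)
Lemma whpP (E : nat -> set T) : whp E <->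
  exists A : nat -> set T, [/\ forall n, measurable (A n),
    forall n, ~` A n `<=` E n & P (A n) @[n --> \oo] --> 0%E].
Proof.
split=> [[A [mA AE PA]]|[A [mA AE PA]]].
  exists (fun n => ~` A n); split.
  - by move=> n; exact: measurableC.
  - by move=> n; rewrite setCK.
  - have -> : (fun n => P (~` A n)) = (fun n => 1 - P (A n))%E.
      by apply/funext => n; rewrite probability_setC.
    rewrite -(@subee R 1%E)//; apply: cvgeB => //; exact: cvg_cst.
exists (fun n => ~` A n); split=> //.
- by move=> n; exact: measurableC.
- have -> : (fun n => P (~` A n)) = (fun n => 1 - P (A n))%E.
    by apply/funext => n; rewrite probability_setC.
  rewrite -[X in _ --> X]sube0; apply: cvgeB => //; exact: cvg_cst.
Qed.

Lemma whpI (E F : nat -> set T) : whp E -> whp F ->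
  whp (fun n => E n `&` F n).
Proof.
move=> /whpP[A [mA AE PA]] /whpP[B [mB BF PB]]; apply/whpP.
exists (fun n => A n `|` B n); split.
- by move=> n; exact: measurableU.
- by move=> n; rewrite setCU; exact: setISS.
- apply: (@squeeze_cvge _ _ _ _ (cst 0%E) _ (fun n => P (A n) + P (B n))%E).
  + by apply: nearW => n; rewrite measure_ge0/= measureU2.
  + exact: cvg_cst.
  + by rewrite -[X in _ --> X](adde0 0%E); exact: cvgeD.
Qed.

(** Finitely many n are free; N = 1 discards the empty sample, for which all averages are 0. *)
Lemma whp_sub_ge N (E F : nat -> set T) :
  (forall n, (N <= n)%N -> E n `<=` F n) -> whp E -> whp F.
Proof.
move=> EF [A [mA AE PA]].
exists (fun n => if (N <= n)%N then A n else set0); split.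
- by move=> n; case: ifP.
- by move=> n w; case: ifP => // Nn /AE; exact: EF.
- apply: cvg_trans PA; apply: near_eq_cvg; near=> n.
  suff -> : (N <= n)%N by [].
  by near: n; exact: nbhs_infty_ge.
Unshelve. all: by end_near. Qed.

Lemma whp_sub (E F : nat -> set T) : (forall n, E n `<=` F n) -> whp E -> whp F.
Proof. by move=> EF; apply: (@whp_sub_ge 0%N) => n _; exact: EF. Qed.

Lemma whpT (E : nat -> set T) : (forall n w, E n w) -> whp E.
Proof.
move=> ET; exists (fun=> setT); split => //.
  by move=> n w _; exact: ET.
rewrite probability_setT; exact: cvg_cst.
Qed.

Lemma whp_forall (I : finType) (E : I -> nat -> set T) :
  (forall i, whp (E i)) -> whp (fun n => [set w | forall i, E i n w]).
Proof.
move=> hE; suff H (s : seq I) :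
    whp (fun n => [set w | forall i, i \in s -> E i n w]).
  apply: whp_sub (H (enum I)) => n w /= Hw i; apply: Hw.
  by rewrite mem_enum.
elim: s => [|i s IH]; first exact: whpT.
apply: whp_sub (whpI (hE i) IH) => n w /= [Ei Es] j.
by rewrite inE => /predU1P[->//|]; exact: Es.
Qed.

Lemma whp_cvg0 (B : nat -> set T) : (forall n, measurable (B n)) ->
  whp (fun n => ~` B n) -> P (B n) @[n --> \oo] --> 0%E.
Proof.
move=> mB /whpP[A [mA AB PA]].
apply: (@squeeze_cvge _ _ _ _ (cst 0%E) _ (fun n => P (A n))) => //.
  apply: nearW => n; rewrite measure_ge0/= le_measure ?inE//.
  by move=> w Bw; apply: contrapT => nAw; exact: AB nAw Bw.
exact: cvg_cst.
Qed.

Lemma cvg0_whp (B : nat -> set T) : (forall n, measurable (B n)) ->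
  P (B n) @[n --> \oo] --> 0%E -> whp (fun n => ~` B n).
Proof. by move=> mB PB; apply/whpP; exists B; split => // n w. Qed.

End tending_to_one.

Lemma measurable_set_gt d (T : measurableType d) (R : realType) (f : T -> R)
    (c : R) : measurable_fun [set: T] f -> measurable [set w | c < f w].
Proof.
move=> mf.
have -> : [set w | c < f w] = [set: T] `&` f @^-1` `]c, +oo[%classic.
  by rewrite setTI; apply/seteqP; split=> w /=; rewrite in_itv/= andbT.
exact: mf.
Qed.

Section law_of_large_numbers.
Context {R : realType} {d : measure_display} {T : measurableType d}.
Variable P : probability T R.
Local Notation whp := (with_probability_tending_to_one P).

Variables (U : nat -> T -> R) (m : R).
Hypotheses (mU : forall i, measurable_fun [set: T] (U i)).
Hypotheses (U_ge0 : forall i w, 0 <= U i w) (U_le1 : forall i w, U i w <= 1).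
Hypothesis EU : forall i, (\int[P]_w (U i w)%:E = m%:E)%E.
Hypothesis EUU : forall i j, i != j ->
  (\int[P]_w (U i w * U j w)%:E = (m * m)%:E)%E.

Let mUU i j : measurable_fun [set: T] (fun w => (U i w * U j w)%:E).
Proof. by apply/measurable_EFinP; exact: measurable_funM. Qed.

Let m_ge0 : 0 <= m.
Proof.
by rewrite -lee_fin -(EU 0); apply: integral_ge0 => w _; rewrite lee_fin.
Qed.

Let S n w := \sum_(i < n) U i w.

Let mS n : measurable_fun [set: T] (S n).
Proof. exact: measurable_sum. Qed.

Let S_ge0 n w : 0 <= S n w.
Proof. exact: sumr_ge0. Qed.

Let ES n : (\int[P]_w (S n w)%:E = (n%:R * m)%:E)%E.
Proof.
rewrite (_ : (fun w => (S n w)%:E) =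
    (fun w => \sum_(i < n) (U i w)%:E)%E); last first.
  by apply/funext => w; rewrite sumEFin.
rewrite ge0_integral_sum; last 3 first.
- exact: measurableT.
- by move=> i; apply/measurable_EFinP; exact: mU.
- by move=> i w _; rewrite lee_fin.
rewrite (eq_bigr (fun=> m%:E)); last by move=> i _; exact: EU.
by rewrite sumEFin sumr_const card_ord mulr_natl.
Qed.

Let ESS n : (\int[P]_w (S n w * S n w)%:E <= (n%:R + n%:R * n%:R * (m * m))%:E)%E.
Proof.
rewrite (_ : (fun w => (S n w * S n w)%:E) =
    (fun w => \sum_(i < n) \sum_(j < n) (U i w * U j w)%:E)%E); last first.
  apply/funext => w; rewrite /S mulr_suml -sumEFin; apply: eq_bigr => i _.
  by rewrite mulr_sumr -sumEFin.
rewrite ge0_integral_sum; last 3 first.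
- exact: measurableT.
- by move=> i; apply: emeasurable_sum => j; exact: mUU.
- by move=> i w _; apply: sume_ge0 => j _; rewrite lee_fin mulr_ge0.
apply: (@le_trans _ _ (\sum_(i < n) \sum_(j < n) ((i == j)%:R + m * m)%:E)%E).
  apply: lee_sum => i _; rewrite ge0_integral_sum; last 3 first.
  - exact: measurableT.
  - by move=> j; exact: mUU.
  - by move=> j w _; rewrite lee_fin mulr_ge0.
  apply: lee_sum => j _; have [<-|ij] := eqVneq i j; last by rewrite add0r EUU.
  apply: (@le_trans _ _ 1%E); last by rewrite lee_fin lerDl mulr_ge0.
  rewrite -[leRHS](@integral_cst_probability _ _ _ P); apply: ge0_le_integral.
  - exact: measurableT.
  - by move=> w _; rewrite lee_fin mulr_ge0.
  - exact: mUU.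
  - exact: measurable_cst.
  - by move=> w _; rewrite lee_fin mulr_ile1.
rewrite (eq_bigr (fun=> (1 + n%:R * (m * m))%:E)).
  rewrite sumEFin sumr_const card_ord lee_fin.
  by rewrite -[leLHS]mulr_natl le_eqVlt; apply/orP; left; apply/eqP; ring.
move=> i _; rewrite sumEFin big_split/= sumr_const card_ord mulr_natl.
by congr ((_ + _)%:E); rewrite (bigD1 i)//= eqxx big1 ?addr0// => j /negbTE;
  rewrite eq_sym => ->.
Qed.

Let V n w := (n%:R^-1 * S n w - m) ^+ 2.

Let mV n : measurable_fun [set: T] (V n).
Proof.
by apply: measurable_funX; apply: measurable_funB => //; exact: measurable_funM.
Qed.

Let EV n : (0 < n)%N -> (\int[P]_w (V n w)%:E <= n%:R^-1%:E)%E.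
Proof.
move=> n0; have nR : 0 < n%:R :> R by rewrite ltr0n.
have nV : 0 < (n%:R : R)^-1 by rewrite invr_gt0.
(* The expanded square, with the cross term moved to the left: every integrand is nonnegative, so
   the integrals add up without any integrability argument. *)
have E : (\int[P]_w (V n w)%:E + (2 * m * n%:R^-1)%:E * \int[P]_w (S n w)%:E =
    (n%:R^-1 ^+ 2)%:E * \int[P]_w (S n w * S n w)%:E + (m ^+ 2)%:E)%E.
  rewrite -ge0_integralZl; last 4 first.
  - exact: measurableT.
  - by apply/measurable_EFinP; exact: mS.
  - by move=> w _; rewrite lee_fin.
  - by rewrite lee_fin !mulr_ge0// ltW.
  rewrite -ge0_integralZl; last 4 first.
  - exact: measurableT.
  - by apply/measurable_EFinP; exact: measurable_funM.
  - by move=> w _; rewrite lee_fin mulr_ge0.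
  - by rewrite lee_fin sqr_ge0.
  rewrite -ge0_integralD; last 5 first.
  - exact: measurableT.
  - by move=> w _; rewrite lee_fin sqr_ge0.
  - by apply/measurable_EFinP; exact: mV.
  - by move=> w _; rewrite -EFinM lee_fin !mulr_ge0// ltW.
  - by apply/measurable_EFinP; apply: measurable_funM.
  rewrite -[(m ^+ 2)%:E in RHS](@integral_cst_probability _ _ _ P).
  rewrite -ge0_integralD; last 5 first.
  - exact: measurableT.
  - by move=> w _; rewrite -EFinM lee_fin !mulr_ge0// ?sqr_ge0// ltW.
  - by apply/measurable_EFinP; apply: measurable_funM => //; exact: measurable_funM.
  - by move=> w _; rewrite lee_fin sqr_ge0.
  - exact: measurable_cst.
  apply: eq_integral => w _; rewrite -!EFinM -!EFinD; congr EFin.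
  by rewrite /V; ring.
have : (\int[P]_w (V n w)%:E + (2 * m * n%:R^-1)%:E * \int[P]_w (S n w)%:E <=
  (n%:R^-1 ^+ 2)%:E * (n%:R + n%:R * n%:R * (m * m))%:E + (m ^+ 2)%:E)%E.
  by rewrite E leeD2r// lee_wpmul2l// lee_fin sqr_ge0.
rewrite ES -!EFinM -EFinD.
have : (0 <= \int[P]_w (V n w)%:E)%E.
  by apply: integral_ge0 => w _; rewrite lee_fin sqr_ge0.
case: (\int[P]_w (V n w)%:E)%E => [r||] //.
rewrite !lee_fin => _.
have -> : 2 * m * n%:R^-1 * (n%:R * m) = 2 * m ^+ 2.
  by field; rewrite gt_eqF.
have -> : n%:R^-1 ^+ 2 * (n%:R + n%:R * n%:R * (m * m)) + m ^+ 2 =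
    n%:R^-1 + 2 * m ^+ 2 :> R.
  by field; rewrite gt_eqF.
by rewrite lerD2r.
Qed.

(** Chebyshev: the variables are pairwise uncorrelated and U_i^2 <= 1, so the mean square deviation
    is at most 1/n. *)
Lemma weak_law_of_large_numbers (delta : R) : 0 < delta ->
  whp (fun n => [set w | `|n%:R^-1 * (\sum_(i < n) U i w) - m| <= delta]).
Proof.
move=> d0.
pose B n := [set w | delta < `|n%:R^-1 * S n w - m|].
have mB n : measurable (B n).
  apply: measurable_set_gt.
  apply: measurableT_comp => //; apply: measurable_funB => //.
  exact: measurable_funM.
apply: (@whp_sub _ _ _ _ (fun n => ~` B n)).
  by move=> n w /= /negP; rewrite -leNgt.
apply: cvg0_whp => //.
have PB n : (0 < n)%N -> (P (B n) <= (n%:R^-1 / delta ^+ 2)%:E)%E.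
  move=> n0.
  have : ((delta ^+ 2)%:E * P (B n) <= n%:R^-1%:E)%E.
    apply: le_trans (EV n0).
    apply: (@le_trans _ _ (\int[P]_w ((delta ^+ 2)%:E * (\1_(B n) w)%:E))%E).
      rewrite ge0_integralZl; last 4 first.
      - exact: measurableT.
      - by apply/measurable_EFinP; exact: measurable_indic.
      - by move=> w _; rewrite lee_fin.
      - by rewrite lee_fin sqr_ge0.
      by rewrite integral_indic// setIT.
    apply: ge0_le_integral.
    - exact: measurableT.
    - by move=> w _; rewrite -EFinM lee_fin mulr_ge0// sqr_ge0.
    - by apply/measurable_EFinP; apply: measurable_funM.
    - by apply/measurable_EFinP; exact: mV.
    - move=> w _; rewrite indicE -EFinM lee_fin.
      case: (boolP (w \in B n)) => [|_]; last by rewrite mulr0 sqr_ge0.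
      rewrite inE /B/= => dw; rewrite mulr1 /V -[leRHS]real_normK ?num_real//.
      by rewrite ler_sqr ?nnegrE ?(ltW d0)// ltW.
  rewrite -(fineK (fin_num_measure P _ (mB n))) -EFinM !lee_fin.
  by rewrite ler_pdivlMr ?exprn_gt0// mulrC.
apply: (@squeeze_cvge _ _ _ _ (cst 0%E) _ (fun n => (n%:R^-1 / delta ^+ 2)%:E)).
- by exists 1%N => // n /= n0; rewrite measure_ge0/= PB.
- exact: cvg_cst.
- apply: cvg_EFin; first exact: nearW.
  rewrite -[X in _ --> X](mul0r (delta ^- 2)); apply: cvgM; last exact: cvg_cst.
  rewrite -cvg_shiftS; exact: cvg_harmonic.
Qed.

End law_of_large_numbers.

Section independence.
Context {R : realType}.

(** The joint law agrees with the product measure on rectangles, hence everywhere; Tonelli does the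
    rest. *)
Lemma independent_integral d d1 d2 (T : measurableType d)
    (T1 : measurableType d1) (T2 : measurableType d2) (P : probability T R)
    (Z1 : {RV P >-> T1}) (Z2 : {RV P >-> T2}) (h : T1 * T2 -> \bar R) :
  independent_rv P Z1 Z2 -> measurable_fun [set: T1 * T2] h ->
  (forall z, 0 <= h z)%E ->
  (\int[P]_w h (Z1 w, Z2 w) =
   \int[distribution P Z1]_x \int[distribution P Z2]_y h (x, y))%E.
Proof.
move=> ind mh h0; pose Z w := (Z1 w, Z2 w).
have mZ : measurable_fun [set: T] Z.
  by apply/measurable_fun_pairP; split; exact: measurable_funP.
pose ZZ : {mfun T >-> (T1 * T2)%type} := mfun_Sub (mem_set mZ).
transitivity (\int[distribution P ZZ]_z h z)%E.
  by rewrite ge0_integral_distribution.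
rewrite -(fubini_tonelli1 h mh h0); apply: eq_measure_integral => A mA _.
by apply/esym; apply: product_measure_unique => // A1 A2 mA1 mA2; exact: ind.
Qed.

Lemma same_law_integral d d' d1 (T : measurableType d) (T' : measurableType d')
    (T1 : measurableType d1) (P : probability T R) (P' : probability T' R)
    (Z : {RV P >-> T1}) (Z' : {RV P' >-> T1}) (g : T1 -> \bar R) :
  same_law P P' Z Z' -> measurable_fun [set: T1] g -> (forall x, 0 <= g x)%E ->
  (\int[P]_w g (Z w) = \int[P']_w g (Z' w))%E.
Proof.
move=> ZZ' mg g0.
have E1 := @ge0_integral_distribution _ _ _ _ _ P Z g mg g0.
have E2 := @ge0_integral_distribution _ _ _ _ _ P' Z' g mg g0.
apply: (etrans (esym E1)); apply: (etrans _ E2).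
by apply: eq_measure_integral => A mA _; exact: ZZ'.
Qed.

Lemma weak_law_iid d d' d1 (T : measurableType d) (T' : measurableType d')
    (T1 : measurableType d1) (P : probability T R) (P' : probability T' R)
    (Z : nat -> {RV P >-> T1}) (Z' : {RV P' >-> T1}) (g : T1 -> R) (m : R) :
  (forall i, same_law P P' (Z i) Z') ->
  (forall i j, i != j -> independent_rv P (Z i) (Z j)) ->
  measurable_fun [set: T1] g -> (forall x, 0 <= g x <= 1) ->
  (\int[P']_w (g (Z' w))%:E = m%:E)%E ->
  forall delta, 0 < delta -> with_probability_tending_to_one P
    (fun n => [set w | `|n%:R^-1 * (\sum_(i < n) g (Z i w)) - m| <= delta]).
Proof.
move=> lawZ indZ mg g01 Eg delta d0.
have mEg : measurable_fun setT (EFin \o g) by exact/measurable_EFinP.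
have g0 x : (0 <= (g x)%:E)%E by rewrite lee_fin; case/andP: (g01 x).
have EZ i : (\int[P]_w (g (Z i w))%:E = m%:E)%E.
  by rewrite -Eg; exact: (@same_law_integral _ _ _ _ _ _ _ _ _ _ (EFin \o g)).
have mgZ i : measurable_fun setT (fun w => g (Z i w)) by exact: measurableT_comp.
apply: (@weak_law_of_large_numbers R d T P (fun i w => g (Z i w)) m) => //.
- by move=> i w; case/andP: (g01 (Z i w)).
- by move=> i w; case/andP: (g01 (Z i w)).
- move=> i j ij; pose h (z : T1 * T1) := ((g z.1)%:E * (g z.2)%:E)%E.
  have mh : measurable_fun setT h.
    by apply: emeasurable_funM; exact: (measurableT_comp mEg).
  have h0 z : (0 <= h z)%E by rewrite mule_ge0.
  have E := independent_integral (indZ i j ij) mh h0.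
  apply: (etrans E).
  have E1 k : (\int[distribution P (Z k)]_x (g x)%:E = m%:E)%E.
    apply: (etrans (@ge0_integral_distribution _ _ _ _ _ P (Z k) _ mEg g0)).
    exact: EZ.
  transitivity (\int[distribution P (Z i)]_x ((g x)%:E * m%:E))%E.
    apply: eq_integral => x _; rewrite /h/= ge0_integralZl//.
    by congr (_ * _)%E; exact: E1.
  rewrite ge0_integralZr//; first by rewrite EFinM; congr (_ * _)%E; exact: E1.
  by rewrite -(EZ i); apply: integral_ge0 => w _.
Qed.

(** Used with f = [inl] and f = [inr], to extract from the joint independence of both samples the
    pairwise independence within each of them. *)
Lemma mutually_independent_pair d d1 (T : measurableType d)
    (T1 : measurableType d1) (P : probability T R) (I J : choiceType)
    (f : I -> J) (F : J -> set (set T)) (Z : I -> T -> T1) : injective f ->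
  (forall i, F (f i) = sigma_rv (Z i)) -> mutually_independent P F ->
  forall i j, i != j -> independent_rv P (Z i) (Z j).
Proof.
move=> injf FE ind i j ij A B mA mB.
pose C k := if k == f i then Z i @^-1` A else Z j @^-1` B.
have ji : f j == f i = false by apply/negbTE; rewrite (inj_eq injf) eq_sym.
have := ind [fset f i; f j]%fset C.
have -> : \bigcap_(k in [set` [fset f i; f j]%fset]) C k =
    Z i @^-1` A `&` Z j @^-1` B.
  apply/seteqP; split=> w /=.
    move=> H; split.
      by have := H (f i); rewrite /C eqxx; apply; rewrite /= !inE eqxx.
    by have := H (f j); rewrite /C ji; apply; rewrite /= !inE eqxx orbT.
  move=> [Ai Bj] k /=; rewrite !inE => /orP[] /eqP ->; rewrite /C ?eqxx ?ji//.
rewrite big_fsetU1/= ?big_seq_fset1; last by rewrite inE eq_sym ji.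
rewrite {2}/C eqxx {2}/C ji; apply => k; rewrite !inE => /orP[] /eqP ->.
  by rewrite FE /C eqxx; exists A => //; rewrite setTI.
by rewrite FE /C ji; exists B => //; rewrite setTI.
Qed.

End independence.

(** * The least squares criterion *)

Section least_squares_gap.
Context {R : realType}.

Lemma sum_empirical_cdf n (ys : nat -> R) y : (0 < n)%N ->
  \sum_(i < n) (ys i <= y)%R%:R = n%:R * empirical_cdf n ys y.
Proof. by move=> n0; rewrite /empirical_cdf mulVKf// pnatr_eq0 -lt0n. Qed.

(** Take the largest sample point ys_j with F_n (ys_j) <= q. All points counted on the left are at
    most ys_j, and n F_n (ys_j) counts the latter, ties included. *)
Lemma sum_empirical_cdf_le n (ys : nat -> R) (q : R) : (0 < n)%N -> 0 <= q ->
  \sum_(i < n) (empirical_cdf n ys (ys i) <= q)%R%:R <= n%:R * q.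
Proof.
move=> n0 q0.
have [/existsP[i0 Pi0]|/existsPn H] :=
    boolP [exists i : 'I_n, (empirical_cdf n ys (ys i) <= q)%R]; last first.
  by rewrite big1 ?mulr_ge0// => i _; rewrite (negbTE (H i)).
pose j := [arg max_(i > i0 | (empirical_cdf n ys (ys (i : 'I_n)) <= q)%R) ys i]%O.
have [Pj jmax] : empirical_cdf n ys (ys j) <= q /\
    forall i : 'I_n, empirical_cdf n ys (ys i) <= q -> ys i <= ys j.
  by rewrite /j; case: Order.TotalTheory.arg_maxP => // k Pk kmax; split.
apply: (@le_trans _ _ (\sum_(i < n) (ys i <= ys j)%R%:R)).
  apply: ler_sum => i _; case: (boolP (_ <= q)) => [/jmax ->//|_].
  by rewrite ler0n.
by rewrite sum_empirical_cdf// ler_wpM2l.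
Qed.

(* If F_n exceeds H by [delta] at [y], it exceeds it by [delta / 2] at all
   sample points below [y] where F_n is at least [F_n y - delta / 2], and those
   have mass at least [delta / 2]. *)
Lemma empirical_cdf_le_of_least_squares n (ys : nat -> R) (H : R -> R)
    (delta : R) : (0 < n)%N -> {homo H : x y / x <= y} -> (forall y, 0 <= H y) ->
  0 < delta ->
  n%:R^-1 * \sum_(j < n) (empirical_cdf n ys (ys j) - H (ys j)) ^+ 2 <
    delta ^+ 3 / 8 ->
  forall y, empirical_cdf n ys y <= H y + delta.
Proof.
move=> n0 ndH H0 d0 small y; rewrite leNgt; apply/negP => Hy.
set p := empirical_cdf n ys y in Hy.
have nR : 0 < n%:R :> R by rewrite ltr0n.
have Hy0 := H0 y.
have q0 : 0 <= p - delta / 2 by lra.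
have h1 := sum_empirical_cdf_le ys n0 q0.
have h2 := sum_empirical_cdf ys y n0.
suff : n%:R * (delta / 2) * (delta ^+ 2 / 4) <=
    \sum_(j < n) (empirical_cdf n ys (ys j) - H (ys j)) ^+ 2.
  move: small; rewrite mulrC ltr_pdivrMr// => /[swap] /le_lt_trans /[apply].
  suff -> : n%:R * (delta / 2) * (delta ^+ 2 / 4) = delta ^+ 3 / 8 * n%:R.
    by rewrite ltxx.
  by field.
(* The first indicators sum to n p, the second to at most n (p - delta/2); their difference is
   positive only at points where the gap is at least delta/2. *)
apply: (@le_trans _ _ (\sum_(j < n) (((ys j <= y)%R%:R -
    (empirical_cdf n ys (ys j) <= p - delta / 2)%R%:R) * (delta ^+ 2 / 4)))).
  rewrite -mulr_suml ler_wpM2r ?divr_ge0 ?sqr_ge0// sumrB.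
  rewrite h2 -/p; lra.
apply: ler_sum => j _.
case: (boolP (ys j <= y)) => yj; last first.
  apply: (@le_trans _ _ 0); last exact: sqr_ge0.
  by rewrite mulr_le0_ge0 ?divr_ge0 ?sqr_ge0// subr_le0 ler_nat.
case: (boolP (_ <= p - _)) => pj; first by rewrite subrr mul0r sqr_ge0.
rewrite subr0 mul1r; have Hj := ndH _ _ yj.
move: pj; rewrite -ltNge => pj.
have -> : delta ^+ 2 / 4 = (delta / 2) ^+ 2 by field.
by rewrite ler_sqr ?nnegrE; lra.
Qed.

Lemma dlse_criterionE k (F : R -> R) n (xs : nat -> 'cV[R]_k) (ys : nat -> R)
    (b : 'cV[R]_k) : measurable_fun [set: R] F ->
  dlse_criterion F n xs ys b = n%:R^-1 * \sum_(j < n)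
    (empirical_cdf n ys (ys j) -
       n%:R^-1 * \sum_(i < n) F (ys j - dot b (xs i))) ^+ 2.
Proof.
move=> mF.
pose f (y : R) := (empirical_cdf n ys y -
  n%:R^-1 * \sum_(i < n) F (y - dot b (xs i))) ^+ 2.
rewrite -[LHS]/(fine (\int[empirical_measure n ys]_y (f y)%:E)%E).
have mf : measurable_fun setT f.
  apply: measurable_funX; apply: measurable_funB.
    apply: measurable_funM => //; apply: measurable_sum => i.
    rewrite (_ : (fun y => _) = \1_(`[ys i, +oo[%classic) :> (R -> R)).
      exact: measurable_indic.
    by apply/funext => y; rewrite indicE mem_setE in_itv/= andbT.
  apply: measurable_funM => //; apply: measurable_sum => i.
  by apply: measurableT_comp => //; exact: measurable_funB.
have f0 y : (0 <= (f y)%:E)%E by rewrite lee_fin sqr_ge0.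
have mEf : measurable_fun setT (EFin \o f) by exact/measurable_EFinP.
rewrite ge0_integral_mscale//.
rewrite ge0_integral_measure_sum//.
under eq_bigr do rewrite integral_dirac// diracT mul1e.
by rewrite sumEFin -EFinM.
Qed.

End least_squares_gap.

(** * Quantiles and the Glivenko-Cantelli theorem *)

Section quantiles.
Context {R : realType} {d : measure_display} {T : measurableType d}.
Variables (P : probability T R) (Z : {RV P >-> R}).

Lemma cdf_fin_num y : cdf Z y \is a fin_num.
Proof. exact: fin_num_measure. Qed.

Lemma cdf_tails (e : R) : 0 < e ->
  exists L, (cdf Z (- L) <= e%:E)%E /\ ((1 - e)%:E <= cdf Z L)%E.
Proof.
move=> e0.
have /fine_cvgP[_ /cvgrPdist_le/(_ _ e0)[M1 [_ H1]]] := cvg_cdfNy0 Z.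
have /fine_cvgP[_ /cvgrPdist_le/(_ _ e0)[M2 [_ H2]]] := cvg_cdfy1 Z.
exists (Num.max (M2 + 1) (1 - M1)); split.
  have {H1}:= H1 (- Num.max (M2 + 1) (1 - M1)).
  rewrite ltrNl lt_max (_ : - M1 < 1 - M1) ?orbT; last by lra.
  move=> /(_ isT); rewrite sub0r normrN /= => H.
  rewrite -(fineK (cdf_fin_num _)) lee_fin; apply: le_trans H.
  exact: ler_norm.
have {H2}:= H2 (Num.max (M2 + 1) (1 - M1)).
rewrite lt_max (_ : M2 < M2 + 1); last by lra.
move=> /(_ isT) /= H.
rewrite -(fineK (cdf_fin_num _)) lee_fin; have := le_trans (ler_norm _) H.
by rewrite lerBlDr addrC -lerBlDr.
Qed.

(** t is the infimum of the z with F(z) >= p. Right continuity gives the first clause and continuity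
    of P from below the third; together they bracket p even when Z has an atom at t. *)
Lemma cdf_quantile (p : R) : 0 < p < 1 -> exists t,
  [/\ (p%:E <= cdf Z t)%E, forall z, z < t -> (cdf Z z < p%:E)%E &
      (P (Z @^-1` `]-oo, t[) <= p%:E)%E].
Proof.
move=> /andP[p0 p1].
pose A := [set z | (p%:E <= cdf Z z)%E].
have [L0 [L0p _]] := cdf_tails (ltac:(lra) : 0 < p / 2).
have [L1 [_ L1p]] := cdf_tails (ltac:(lra) : 0 < 1 - p).
have AL1 : A L1 by rewrite /A/= (le_trans _ L1p)// lee_fin; lra.
have lbA : lbound A (- L0).
  move=> z Az; rewrite leNgt; apply/negP => zL0.
  have : (p%:E <= (p / 2)%:E)%E.
    apply: (le_trans Az); apply: le_trans L0p.
    by apply: cdf_nondecreasing; exact: ltW.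
  by rewrite lee_fin; lra.
have infA : has_inf A by split; [exists L1|exists (- L0)].
pose t := inf A.
have below z : z < t -> (cdf Z z < p%:E)%E.
  move=> zt; rewrite ltNge; apply/negP => Az.
  by have := ge_inf infA.2 Az; rewrite leNgt zt.
have above z : t < z -> (p%:E <= cdf Z z)%E.
  move=> tz; have [y Ay yz] := inf_lt infA.1 tz.
  by apply: (le_trans Ay); apply: cdf_nondecreasing; exact: ltW.
exists t; split => //.
- have rc := @cdf_right_continuous _ _ _ P Z t.
  rewrite -(cvg_lim _ rc)//; apply: lime_ge.
    by apply/cvg_ex; eexists; exact: rc.
  near=> z; apply: above; near: z; exact: nbhs_right_gt.
- pose F n := Z @^-1` `]-oo, (t - n.+1%:R^-1)%R]%classic.
  have mF n : measurable (F n) by exact: measurable_funPTI.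
  have UF : Z @^-1` `]-oo, t[%classic = \bigcup_n F n.
    apply/seteqP; split=> w /=.
      rewrite in_itv/= => Zt; have tZ : 0 < t - Z w by rewrite subr_gt0.
      exists (Num.truncn ((t - Z w)^-1)) => //; rewrite /F/= in_itv/=.
      rewrite lerBrDl -lerBrDr -[leRHS]invrK lef_pV2 ?posrE ?invr_gt0//.
      by apply/ltW; exact: truncnS_gt.
    move=> [n _]; rewrite /F/= !in_itv/= => /le_lt_trans; apply.
    by rewrite ltrBlDr ltrDl invr_gt0.
  have mU : measurable (\bigcup_n F n) by exact: bigcup_measurable.
  have ndF : nondecreasing_seq F.
    move=> m n mn; apply/subsetPset; apply: preimage_subset.
    apply: subset_itvl; rewrite bnd_simp.
    by rewrite lerB// lef_pV2 ?posrE// ler_nat.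
  have c := @nondecreasing_cvg_mu _ _ _ P F mF mU ndF.
  rewrite UF -(cvg_lim _ c)//; apply: lime_le.
    by apply/cvg_ex; eexists; exact: c.
  apply: nearW => n; apply/ltW; apply: below.
  by rewrite ltrBlDr ltrDl invr_gt0.
Unshelve. all: by end_near. Qed.

End quantiles.

Section glivenko_cantelli.
Context {R : realType} {d d' : measure_display} {T : measurableType d}
  {T' : measurableType d'}.
Variables (P : probability T R) (P' : probability T' R) (Z : {RV P' >-> R}).

(* [m n w] stands for a (random) probability measure; only monotonicity is
   needed. *)
Lemma glivenko_cantelli (m : nat -> T -> set R -> R) :
  (forall n w A, measurable A -> 0 <= m n w A <= 1) ->
  (forall n w A B, measurable A -> measurable B -> A `<=` B ->
     m n w A <= m n w B) ->
  (forall A delta, measurable A -> 0 < delta ->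
     with_probability_tending_to_one P (fun n =>
       [set w | `|m n w A - fine (P' (Z @^-1` A))| <= delta])) ->
  forall delta, 0 < delta -> with_probability_tending_to_one P (fun n =>
    [set w | forall y, `|m n w `]-oo, y]%classic - fine (cdf Z y)| <= delta]).
Proof.
move=> m01 mono conv delta d0.
have d20 : 0 < delta / 2 by lra.
(* The levels (i + 1) / (N + 1) avoid 0 and 1, where a quantile need not exist. Their spacing q is
   at most delta/2; the other half of delta pays for the convergence at the quantiles. *)
pose N := Num.truncn (2 / delta).
have N0 : 0 < N.+1%:R :> R by rewrite ltr0n.
have [q qE] : {q : R | q = N.+1%:R^-1} by eexists.
have q0 : 0 < q by rewrite qE invr_gt0.
have Nq : N.+1%:R * q = 1 by rewrite qE divff// gt_eqF.
have qd : q <= delta / 2.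
  rewrite qE -[leRHS]invrK lef_pV2 ?posrE ?invr_gt0// invf_div.
  by apply/ltW; exact: truncnS_gt.
pose p (i : 'I_N) : R := i.+1%:R * q.
have p01 (i : 'I_N) : 0 < p i < 1.
  by rewrite mulr_gt0//= -[ltRHS]Nq ltr_pM2r// ltr_nat ltnS.
pose t (i : 'I_N) := sval (cid (cdf_quantile Z (p01 i))).
have tP (i : 'I_N) := svalP (cid (cdf_quantile Z (p01 i))).
rewrite -/(t _) in tP.
(* Both the closed and the open half-line are needed at each quantile, since the law may jump
   there. *)
apply: whp_sub (whpI
  (whp_forall (fun i : 'I_N =>
     conv `]-oo, t i]%classic _ (measurable_itv _) d20))
  (whp_forall (fun i : 'I_N =>
     conv `]-oo, t i[%classic _ (measurable_itv _) d20))) => n w [/= up lo] y.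
pose F y := fine (cdf Z y).
have FE z : cdf Z z = (F z)%:E by rewrite fineK ?cdf_fin_num.
have tP1 i : p i <= F (t i) by have [+ _ _] := tP i; rewrite FE lee_fin.
have tP2 i z : z < t i -> F z < p i.
  by have [_ + _] := tP i => /(_ z) /[apply]; rewrite FE lte_fin.
have tP3 i : fine (P' (Z @^-1` `]-oo, t i[%classic)) <= p i.
  have [_ _ +] := tP i; rewrite -lee_fin fineK// fin_num_measure//.
  exact: measurable_funPTI.
have up' i : F (t i) - delta / 2 <= m n w `]-oo, t i]%classic.
  by have := up i; rewrite ler_norml => /andP[+ _]; rewrite -/(F _); lra.
have lo' i : m n w `]-oo, t i[%classic <= p i + delta / 2.
  by have := lo i; rewrite ler_norml => /andP[_ +]; have := tP3 i; lra.
have Fy0 : 0 <= F y by rewrite -lee_fin -FE cdf_ge0.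
have Fy1 : F y <= 1 by rewrite -lee_fin -FE cdf_le1.
have ndF x z : x <= z -> F x <= F z.
  by move=> xz; rewrite -lee_fin -!FE cdf_nondecreasing.
have /andP[m0 m1] := m01 n w _ (measurable_itv `]-oo, y]).
(* F y lies in [k q, (k + 1) q). The quantile of level (k + 1) q, of index k, bounds from above and
   that of level k q, of index k - 1, from below; at the ends the bounds 0 and 1 replace a missing
   quantile. *)
pose k := Num.truncn (F y * N.+1%:R).
have /andP[k1 k2] : k%:R <= F y * N.+1%:R < k.+1%:R.
  by rewrite truncn_itv// mulr_ge0// ltW.
have {}k1 : k%:R * q <= F y by rewrite qE ler_pdivrMr.
have {}k2 : F y < k.+1%:R * q by rewrite qE ltr_pdivlMr.
have step j : j.+1%:R * q = j%:R * q + q by rewrite -natr1 mulrDl mul1r.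
have NqS := step N; rewrite Nq in NqS.
rewrite ler_norml -/(F y); apply/andP; split; last first.
  have [kN|Nk] := ltnP k N; last first.
    have : N%:R * q <= F y by apply: le_trans k1; rewrite ler_pM2r// ler_nat.
    lra.
  pose i := Ordinal kN.
  have yt : y < t i.
    rewrite ltNge; apply/negP => ty; have := tP1 i; have := ndF _ _ ty.
    rewrite /p/=; lra.
  have : m n w `]-oo, y]%classic <= m n w `]-oo, t i[%classic.
    apply: mono => // z /=; rewrite !in_itv/= => zy; exact: le_lt_trans yt.
  have := lo' i; rewrite /p/=; have := step k; lra.
have [N00|N00] := posnP N; first by move: NqS; rewrite N00 mul0r; lra.
have [k0|k0] := posnP k; first by move: k2; rewrite k0 mul1r; lra.
have [i [pi1 pi2]] : exists i : 'I_N, p i <= F y /\ F y <= p i + q.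
  have [kN|Nk] := leqP k N.
    have kN' : (k.-1 < N)%N by rewrite prednK.
    exists (Ordinal kN'); rewrite /p/= prednK//; split => //.
    by rewrite -step ltW.
  (* Here k > N, that is F y = 1, and the last index serves. *)
  have N1 : (N.-1 < N)%N by rewrite prednK.
  exists (Ordinal N1); rewrite /p/= prednK// -NqS; split => //.
  by apply: le_trans k1; rewrite ler_pM2r// ler_nat ltnW.
have ty : t i <= y.
  by rewrite leNgt; apply/negP => /tP2; lra.
have : m n w `]-oo, t i]%classic <= m n w `]-oo, y]%classic.
  by apply: mono => // z /=; rewrite !in_itv/= => /le_trans; apply.
have := up' i; have := tP1 i; lra.
Qed.

End glivenko_cantelli.

(** * The regression model with Gaussian covariates *)

Lemma ge0_integral_law d (T : measurableType d) (R : realType)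
    (P : probability T R) (W : T -> R) (m : probability (measurableTypeR R) R)
    (f : R -> \bar R) :
  measurable_fun [set: T] W -> measurable_fun [set: R] f ->
  (forall x, 0 <= f x)%E ->
  (forall A : set R, measurable A -> P (W @^-1` A) = m A) ->
  (\int[P]_w f (W w) = \int[m]_t f t)%E.
Proof.
move=> mW mf f0 WA; pose W' : T -> measurableTypeR R := W.
have mW' : measurable_fun [set: T] W' by exact: mW.
pose f' : measurableTypeR R -> \bar R := f.
have mf' : measurable_fun [set: measurableTypeR R] f' by exact: mf.
apply: (etrans (esym (ge0_integral_pushforward mW' P measurableT mf' (in1W f0)))).
by apply: eq_measure_integral => A mA _; exact: WA.
Qed.

Section regression_model.
Context {R : realType} {k : nat} {d0 : measure_display} {T0 : measurableType d0}.
Variables (P0 : probability T0 R) (X : {RV P0 >-> 'cV[R]_k}) (eps : {RV P0 >-> R}).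

Lemma dotE (b x : 'cV[R]_k) : dot b x = \sum_i b i ord0 * x i ord0.
Proof. by rewrite /dot mxE; apply: eq_bigr => i _; rewrite mxE. Qed.

Lemma measurable_dot (b : 'cV[R]_k) : measurable_fun [set: 'cV[R]_k] (dot b).
Proof.
rewrite (_ : dot b = fun x => \sum_i b i ord0 * x i ord0); last first.
  by apply/funext => x; exact: dotE.
apply: measurable_sum => i; apply: measurable_funM => //.
exact: measurable_mx_entry.
Qed.

Lemma measurable_dot_add (b : 'cV[R]_k) :
  measurable_fun [set: 'cV[R]_k * R] (fun z => dot b z.1 + z.2).
Proof.
apply: measurable_funD => //.
by apply: (measurableT_comp (measurable_dot b)).
Qed.

Lemma measurable_regression (b : 'cV[R]_k) :
  measurable_fun [set: T0] (fun w => dot b (X w) + eps w).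
Proof.
by apply: measurable_funD => //; apply: (measurableT_comp (measurable_dot b)).
Qed.

Definition regression (b : 'cV[R]_k) : {RV P0 >-> R} :=
  mfun_Sub (mem_set (measurable_regression b)).

(* For B = ]-oo, y] this is F^eps (y - b^T x). *)
Definition noise_prob (b : 'cV[R]_k) (B : set R) (x : 'cV[R]_k) : R :=
  fine (P0 (eps @^-1` [set e | B (dot b x + e)])).

Let measurable_shifted (B : set R) (c : R) : measurable B ->
  measurable [set e | B (c + e)].
Proof.
move=> mB; rewrite -[X in measurable X]setTI.
have mf : measurable_fun [set: R] (fun e : R => c + e) by exact: measurable_funD.
exact: mf.
Qed.

Let noise_probE b B x : measurable B ->
  (noise_prob b B x)%:E = P0 (eps @^-1` [set e | B (dot b x + e)]).
Proof.
move=> mB; rewrite fineK// fin_num_measure//; apply: measurable_funPTI => //.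
exact: measurable_shifted.
Qed.

Let noise_prob_integral b B x : measurable B ->
  (noise_prob b B x)%:E =
  (\int[distribution P0 eps]_e (\1_B (dot b x + e))%:E)%E.
Proof.
move=> mB; rewrite noise_probE//.
rewrite (_ : (fun e : R => (\1_B (dot b x + e))%:E) =
  (fun e : R => (\1_[set e | B (dot b x + e)] e)%:E)); last first.
  by apply/funext => e; rewrite !indicE.
by rewrite integral_indic ?setIT//; exact: measurable_shifted.
Qed.

Let measurable_indic_dot_add b B : measurable B ->
  measurable_fun [set: 'cV[R]_k * R]
    (fun z => (\1_B (dot b z.1 + z.2))%:E : \bar R).
Proof.
move=> mB; apply/measurable_EFinP.
exact: (measurableT_comp (measurable_indic mB) (measurable_dot_add b)).
Qed.

Lemma measurable_noise_prob b B : measurable B ->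
  measurable_fun [set: 'cV[R]_k] (noise_prob b B).
Proof.
move=> mB; apply/measurable_EFinP.
have := @measurable_fun_fubini_tonelli_F _ _ _ _ _ (distribution P0 eps) _
  (measurable_indic_dot_add b mB).
rewrite (_ : fubini_F _ _ = EFin \o noise_prob b B).
  by apply => z; rewrite lee_fin.
by apply/funext => x; rewrite /= noise_prob_integral.
Qed.

Lemma noise_prob_itv b B x : measurable B -> 0 <= noise_prob b B x <= 1.
Proof.
move=> mB; apply/andP; split; rewrite -lee_fin noise_probE//.
apply: probability_le1; apply: measurable_funPTI => //.
exact: measurable_shifted.
Qed.

Lemma le_noise_prob b A B x : measurable A -> measurable B -> A `<=` B ->
  noise_prob b A x <= noise_prob b B x.
Proof.
move=> mA mB AB; rewrite -lee_fin !noise_probE// le_measure ?inE//.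
- by apply: measurable_funPTI => //; exact: measurable_shifted.
- by apply: measurable_funPTI => //; exact: measurable_shifted.
- by move=> w /=; exact: AB.
Qed.

Lemma noise_prob_cdf b y x :
  noise_prob b `]-oo, y]%classic x = fine (cdf eps (y - dot b x)).
Proof.
congr (fine (P0 _)); apply/seteqP; split=> w /=; rewrite !in_itv/=; lra.
Qed.

Hypothesis indep : independent_rv P0 X eps.

(** [noise_prob b B (X w)] is the conditional probability, given X, that b^T X + eps falls in B. The
    fitted distribution function is thus an average of i.i.d. terms with the right mean. *)
Lemma integral_noise_prob b B : measurable B ->
  (\int[P0]_w (noise_prob b B (X w))%:E = P0 (regression b @^-1` B))%E.
Proof.
move=> mB.
have mn : measurable_fun setT (EFin \o noise_prob b B).
  by apply/measurable_EFinP; exact: measurable_noise_prob.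
have n0 x : (0 <= (EFin \o noise_prob b B) x)%E.
  by rewrite lee_fin; case/andP: (noise_prob_itv b x mB).
have E1 := @ge0_integral_distribution _ _ _ _ _ P0 X _ mn n0.
apply: (etrans (esym E1)).
have h0 (z : 'cV[R]_k * R) : (0 <= (\1_B (dot b z.1 + z.2))%:E :> \bar R)%E.
  by rewrite lee_fin.
have E2 := independent_integral indep (measurable_indic_dot_add b mB) h0.
transitivity (\int[distribution P0 X]_x \int[distribution P0 eps]_e
  (\1_B (dot b x + e))%:E)%E.
  by apply: eq_integral => x _; exact: noise_prob_integral.
apply: (etrans (esym E2)).
rewrite (_ : (fun w => _) =
    (fun w => (\1_(regression b @^-1` B) w)%:E)); last first.
  by apply/funext => w; rewrite !indicE.
by rewrite integral_indic ?setIT//; exact: measurable_funPTI.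
Qed.

Variable Sigma : 'M[R]_k.
Hypothesis X_normal : multivariate_normal P0 X 0 Sigma.

Definition qform (b : 'cV[R]_k) : R := (b^T *m Sigma *m b) ord0 ord0.

Lemma qform_ge0 b : 0 <= qform b.
Proof. by have [_ + _] := X_normal; apply. Qed.

Lemma dot_normal b (A : set R) : measurable A ->
  P0 ((fun w => dot b (X w)) @^-1` A) = gaussian (qform b) A.
Proof.
move=> mA; have [_ _ ->//] := X_normal.
by rewrite gaussianE dotE big1// => i _; rewrite mxE mulr0.
Qed.

Lemma integral_dot_normal b (f : R -> \bar R) : measurable_fun [set: R] f ->
  (forall x, 0 <= f x)%E ->
  (\int[P0]_w f (dot b (X w)) = \int[gaussian (qform b)]_t f t)%E.
Proof.
move=> mf f0.
apply: ge0_integral_law => //; last exact: dot_normal.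
by apply: (measurableT_comp (measurable_dot b)).
Qed.

Lemma convolved_cdfE b y :
  convolved_cdf X eps b y = smoothed (cdf eps) (qform b) y.
Proof.
have mF : measurable_fun setT (fun t : R => cdf eps (y - t)).
  by apply: (measurableT_comp (cdf_measurable eps)); exact: measurable_funB.
have mFd : measurable_fun setT (fun x : 'cV[R]_k => cdf eps (y - dot b x)).
  exact: (measurableT_comp mF (measurable_dot b)).
apply: (etrans (@ge0_integral_distribution _ _ _ _ _ P0 X _ mFd
  (fun=> cdf_ge0 _ _))).
exact: (@integral_dot_normal b (fun t => cdf eps (y - t)) mF (fun=> cdf_ge0 _ _)).
Qed.

Lemma cdf_regression b y :
  cdf (regression b) y = smoothed (cdf eps) (qform b) y.
Proof.
rewrite -convolved_cdfE /convolved_cdf.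
have mI : measurable `]-oo, y]%classic by exact: measurable_itv.
apply: (etrans (esym (integral_noise_prob b mI))).
have mn : measurable_fun setT (EFin \o noise_prob b `]-oo, y]%classic).
  by apply/measurable_EFinP; exact: measurable_noise_prob.
have n0 x : (0 <= (EFin \o noise_prob b `]-oo, y]%classic) x)%E.
  by rewrite lee_fin; case/andP: (noise_prob_itv b x mI).
apply: (etrans (esym (@ge0_integral_distribution _ _ _ _ _ P0 X _ mn n0))).
by apply: eq_integral => x _; rewrite /= noise_prob_cdf fineK// cdf_fin_num.
Qed.

End regression_model.

(** * Quadratic forms and finite nets *)

Section quadratic_form.
Context {R : realType} {k : nat}.
Implicit Types (S : 'M[R]_k) (b c x : 'cV[R]_k).

Lemma qformE S b : qform S b = \sum_i \sum_j b i ord0 * S i j * b j ord0.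
Proof.
rewrite /qform mxE exchange_big/=; apply: eq_bigr => j _.
rewrite mxE mulr_suml; apply: eq_bigr => i _; by rewrite mxE.
Qed.

Lemma dotZ (a : R) b x : dot (a *: b) x = a * dot b x.
Proof. by rewrite !dotE mulr_sumr; apply: eq_bigr => i _; rewrite mxE mulrA. Qed.

Lemma le_dot_diff b c x (rho : R) : (forall i, `|b i ord0 - c i ord0| <= rho) ->
  `|dot b x - dot c x| <= rho * \sum_i `|x i ord0|.
Proof.
move=> bc; rewrite !dotE -sumrB mulr_sumr (le_trans (ler_norm_sum _ _ _))//.
by apply: ler_sum => i _; rewrite -mulrBl normrM ler_wpM2r.
Qed.

Lemma le_qform_diff S b c (M rho : R) :
  (forall i, `|b i ord0| <= M) -> (forall i, `|c i ord0| <= M) ->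
  (forall i, `|b i ord0 - c i ord0| <= rho) ->
  `|qform S b - qform S c| <= 2 * M * rho * \sum_i \sum_j `|S i j|.
Proof.
move=> bM cM bc; rewrite !qformE -sumrB mulr_sumr (le_trans (ler_norm_sum _ _ _))//.
apply: ler_sum => i _; rewrite -sumrB mulr_sumr (le_trans (ler_norm_sum _ _ _))//.
apply: ler_sum => j _.
have -> : b i ord0 * S i j * b j ord0 - c i ord0 * S i j * c j ord0 =
  S i j * (b i ord0 * (b j ord0 - c j ord0) + (b i ord0 - c i ord0) * c j ord0).
  by ring.
rewrite normrM mulrC ler_wpM2r// (le_trans (ler_normD _ _))// !normrM.
have h1 : `|b i ord0| * `|b j ord0 - c j ord0| <= M * rho by exact: ler_pM.
have h2 : `|b i ord0 - c i ord0| * `|c j ord0| <= rho * M by exact: ler_pM.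
lra.
Qed.

Lemma le_qform_diff_mx S S' b (M e : R) : (forall i, `|b i ord0| <= M) ->
  (forall i j, `|S i j - S' i j| <= e) ->
  `|qform S b - qform S' b| <= k%:R * (k%:R * (M * e * M)).
Proof.
move=> bM SS'; rewrite !qformE -sumrB (le_trans (ler_norm_sum _ _ _))//.
apply: (@le_trans _ _ (\sum_(i < k) (k%:R * (M * e * M)))); last first.
  by rewrite sumr_const card_ord -[leLHS]mulr_natl.
apply: ler_sum => i _; rewrite -sumrB (le_trans (ler_norm_sum _ _ _))//.
apply: (@le_trans _ _ (\sum_(i < k) (M * e * M))); last first.
  by rewrite sumr_const card_ord -[leLHS]mulr_natl.
apply: ler_sum => j _; rewrite -mulrBl -mulrBr !normrM.
by apply: ler_pM => //; rewrite ?mulr_ge0//; apply: ler_pM.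
Qed.

Lemma qform_subZ S b c (t : R) : qform S (b - t *: c) = qform S b -
  t * (c^T *m S *m b) ord0 ord0 - t * (b^T *m S *m c) ord0 ord0 +
  t ^+ 2 * qform S c.
Proof.
have tE : (b - t *: c)^T = b^T - t *: c^T by rewrite linearB linearZ.
rewrite /qform tE !mulmxBl !mulmxBr -!scalemxAl -!scalemxAr.
by rewrite !mxE; ring.
Qed.

(* Cauchy-Schwarz for the form S against the vector S^-1 e_i. *)
Lemma sqr_coord_le_qform S : S \in unitmx -> S^T = S ->
  (forall b, 0 <= qform S b) ->
  exists2 C, 0 < C & forall b i, b i ord0 ^+ 2 <= C * qform S b.
Proof.
move=> uS symS S0; pose v i : 'cV[R]_k := invmx S *m delta_mx i ord0.
have Sv i : S *m v i = delta_mx i ord0 by rewrite mulKVmx.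
have C0 : 0 < 1 + \sum_i qform S (v i) by rewrite ltr_wpDr// sumr_ge0.
exists (1 + \sum_i qform S (v i)) => // b i.
(* The added 1 makes the denominator of t positive before anything is known about the sign of
   [qform S (v i)] beyond nonnegativity; the minimizing t would have no 1. *)
pose Q := 1 + qform S (v i).
have Q0 : 0 < Q by rewrite ltr_wpDr.
have QC : Q <= 1 + \sum_i qform S (v i).
  by rewrite lerD2l (bigD1 i)//= lerDl sumr_ge0.
apply: (@le_trans _ _ (Q * qform S b)); last by rewrite ler_wpM2r.
pose t := b i ord0 / Q.
have expand : qform S (b - t *: v i) =
    qform S b - 2 * t * b i ord0 + t ^+ 2 * qform S (v i).
  have bv : (b^T *m S *m v i) ord0 ord0 = b i ord0.
    rewrite -mulmxA Sv mxE (bigD1 i)//= big1 ?addr0.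
      by rewrite !mxE !eqxx /= mulr1.
    by move=> j ji; rewrite !mxE (negbTE ji) /= mulr0.
  have vb : ((v i)^T *m S *m b) ord0 ord0 = b i ord0.
    have E (u : 'cV[R]_k) : (u^T *m S *m b)^T = b^T *m S *m u.
      by rewrite !trmx_mul trmxK symS mulmxA.
    by rewrite -bv -E [RHS]mxE.
  by rewrite qform_subZ bv vb; ring.
have := S0 (b - t *: v i); rewrite expand => h.
have qQ : qform S (v i) = Q - 1 by rewrite /Q addrC addKr.
have tQ : b i ord0 = t * Q by rewrite divfK// gt_eqF.
rewrite qQ tQ in h *.
have : 0 <= Q * (qform S b - 2 * t * (t * Q) + t ^+ 2 * (Q - 1)).
  by rewrite mulr_ge0// ltW.
have : 0 <= Q * t ^+ 2 by rewrite mulr_ge0 ?sqr_ge0// ltW.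
nra.
Qed.

(** A grid of mesh rho. Its points stay in the box because [le_qform_diff] asks for a bound on both
    of its arguments. *)
Lemma box_net (M rho : R) : 0 <= M -> 0 < rho ->
  exists (I : finType) (g : I -> 'cV[R]_k), (forall t i, `|g t i ord0| <= M) /\
    forall b, (forall i, `|b i ord0| <= M) ->
      exists t, forall i, `|b i ord0 - g t i ord0| <= rho.
Proof.
move=> M0 rho0; pose N := (Num.truncn (2 * M / rho)).+1.
exists {ffun 'I_k -> 'I_N},
  (fun t : {ffun 'I_k -> 'I_N} => \col_i (- M + rho * (t i)%:R)); split.
  move=> t i; rewrite mxE ler_norml.
  have : rho * (t i)%:R <= 2 * M.
    rewrite mulrC -ler_pdivlMr//.
    apply: (@le_trans _ _ (Num.truncn (2 * M / rho))%:R).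
      by rewrite ler_nat -ltnS ltn_ord.
    by rewrite truncn_le// divr_ge0 ?mulr_ge0// ltW.
  have : 0 <= rho * (t i)%:R by rewrite mulr_ge0// ltW.
  lra.
move=> b bM.
have bi i : 0 <= (b i ord0 + M) / rho.
  by rewrite divr_ge0 ?(ltW rho0)//; have := bM i; rewrite ler_norml; lra.
have bN i : (Num.truncn ((b i ord0 + M) / rho) < N)%N.
  rewrite ltnS; apply: le_truncn.
  rewrite ler_wpM2r ?invr_ge0 ?(ltW rho0)//.
  by have := bM i; rewrite ler_norml; lra.
exists [ffun i => Ordinal (bN i)] => i; rewrite mxE ffunE/=.
have /andP[] := truncn_itv (bi i); rewrite ler_pdivlMr// ltr_pdivrMr//.
set n := Num.truncn _; rewrite -natr1 mulrDl mul1r => h1 h2.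
rewrite ler_norml (mulrC rho); lra.
Qed.

End quadratic_form.

(** * Uniform control of the fit and of the estimator *)

Section dlse.
Context {R : realType} {k : nat}.
Context {d0 : measure_display} {T0 : measurableType d0} (P0 : probability T0 R).
Context (X : {RV P0 >-> 'cV[R]_k}) (eps Y : {RV P0 >-> R}) (beta0 : 'cV[R]_k).
Hypothesis indep_X_eps : independent_rv P0 X eps.
Hypothesis law_Y : same_law P0 P0 Y (fun w => dot beta0 (X w) + eps w).
Context {d : measure_display} {T : measurableType d} (P : probability T R).
Context (Xs : nat -> {RV P >-> 'cV[R]_k}) (Ys : nat -> {RV P >-> R}).
Hypothesis law_Xs : forall i, same_law P P0 (Xs i) X.
Hypothesis law_Ys : forall i, same_law P P0 (Ys i) Y.
Hypothesis indep_Xs : forall i j, i != j -> independent_rv P (Xs i) (Xs j).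
Hypothesis indep_Ys : forall i j, i != j -> independent_rv P (Ys i) (Ys j).
Context (betahat : nat -> T -> 'cV[R]_k).

Local Notation whp := (with_probability_tending_to_one P).
Local Notation Feps := (fun y => fine (cdf eps y)).
Local Notation FY := (fun y => fine (cdf Y y)).

Hypothesis betahat_dlse : whp (fun n => [set w | is_dlse Feps n
  (fun i => Xs i w) (fun i => Ys i w) (betahat n w)]).

Definition mean n (u : nat -> R) : R := n%:R^-1 * \sum_(i < n) u i.

Lemma mean_itv n u : (forall i, 0 <= u i <= 1) -> 0 <= mean n u <= 1.
Proof.
move=> u01; have u0 i : 0 <= u i by case/andP: (u01 i).
rewrite mulr_ge0 ?invr_ge0 ?sumr_ge0//=.
have [->|n0] := posnP n; first by rewrite /mean invr0 mul0r.
rewrite ler_pdivrMl ?ltr0n// mulr1.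
apply: (@le_trans _ _ (\sum_(i < n) 1)); last by rewrite sumr_const card_ord.
by apply: ler_sum => i _; case/andP: (u01 i).
Qed.

Lemma le_mean n u v : (forall i, u i <= v i) -> mean n u <= mean n v.
Proof. by move=> uv; rewrite ler_wpM2l ?invr_ge0//; exact: ler_sum. Qed.

Lemma meanD n u v : mean n (fun i => u i + v i) = mean n u + mean n v.
Proof. by rewrite /mean big_split mulrDr. Qed.

(** An inequality only, because the mean over n = 0 terms is 0. *)
Lemma mean_cst_le n (c : R) : 0 <= c -> mean n (fun=> c) <= c.
Proof.
move=> c0; have [->|n0] := posnP n; first by rewrite /mean invr0 mul0r.
by rewrite /mean sumr_const card_ord -[c *+ n]mulr_natl mulKf// pnatr_eq0 -lt0n.
Qed.

Definition fitted_cdf n w (b : 'cV[R]_k) (y : R) : R :=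
  mean n (fun i => Feps (y - dot b (Xs i w))).

Let Feps_nd : {homo Feps : x y / x <= y}.
Proof. by move=> x y xy; rewrite fine_le ?cdf_fin_num// cdf_nondecreasing. Qed.

Let Feps_ge0 y : 0 <= Feps y.
Proof. by rewrite fine_ge0// cdf_ge0. Qed.

Let Feps_le1 y : Feps y <= 1.
Proof. by rewrite -lee_fin fineK ?cdf_fin_num// cdf_le1. Qed.

Let mFeps : measurable_fun [set: R] Feps.
Proof.
apply/measurable_EFinP; apply: eq_measurable_fun (cdf_measurable eps) => y _.
by rewrite /= fineK// cdf_fin_num.
Qed.

Lemma fitted_cdf_nd n w b : {homo fitted_cdf n w b : x y / x <= y}.
Proof. by move=> x y xy; apply: le_mean => i; apply: Feps_nd; rewrite lerD2r. Qed.

Lemma fitted_cdf_ge0 n w b y : 0 <= fitted_cdf n w b y.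
Proof.
by have /andP[] := @mean_itv n (fun i => Feps (y - dot b (Xs i w)))
  (fun i => introT andP (conj (Feps_ge0 _) (Feps_le1 _))).
Qed.

Lemma cdf_response y : cdf Y y = cdf (regression X eps beta0) y.
Proof. exact: (law_Y (measurable_itv `]-oo, y])). Qed.

Lemma whp_mean_X (g : 'cV[R]_k -> R) (m delta : R) :
  measurable_fun [set: 'cV[R]_k] g -> (forall x, 0 <= g x <= 1) ->
  (\int[P0]_w (g (X w))%:E = m%:E)%E -> 0 < delta ->
  whp (fun n => [set w | `|mean n (fun i => g (Xs i w)) - m| <= delta]).
Proof.
by move=> mg g01 Eg d_gt0; exact: (weak_law_iid law_Xs indep_Xs mg g01 Eg d_gt0).
Qed.

(** [glivenko_cantelli] applied to the random measure that averages [noise_prob b A] over the X_i.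
    Here b is fixed; uniformity in b comes later. *)
Lemma whp_fitted_cdf b delta : 0 < delta -> whp (fun n => [set w | forall y,
  `|fitted_cdf n w b y - fine (cdf (regression X eps b) y)| <= delta]).
Proof.
move=> delta0.
have := @glivenko_cantelli R _ _ _ _ P P0 (regression X eps b)
  (fun n w A => mean n (fun i => noise_prob eps b A (Xs i w))).
move=> /(_ _ _ _ delta delta0) gc.
apply: whp_sub (gc _ _ _) => [n w /= H y|n w A mA|n w A B mA mB AB|A e mA e0].
- have := H y; congr (`|_ - _| <= _).
  by congr mean; apply/funext => i; rewrite noise_prob_cdf.
- by apply: mean_itv => i; exact: noise_prob_itv.
- by apply: le_mean => i; exact: le_noise_prob.
- apply: whp_mean_X => //; first exact: measurable_noise_prob.
  + by move=> x; exact: noise_prob_itv.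
  + rewrite fineK ?fin_num_measure//; last exact: measurable_funPTI.
    exact: integral_noise_prob.
Qed.

Lemma whp_empirical_cdf delta : 0 < delta -> whp (fun n => [set w | forall y,
  `|empirical_cdf n (fun i => Ys i w) y - FY y| <= delta]).
Proof.
move=> delta0.
have := @glivenko_cantelli R _ _ _ _ P P0 Y
  (fun n w A => mean n (fun i => \1_A (Ys i w))).
move=> /(_ _ _ _ delta delta0) gc.
apply: whp_sub (gc _ _ _) => [n w /= H y|n w A mA|n w A B mA mB AB|A e mA e0].
- have := H y; congr (`|_ - _| <= _).
  congr (_ * _); apply: eq_bigr => i _.
  by rewrite indicE mem_setE in_itv.
- by apply: mean_itv => i; rewrite indicE ler0n lern1 leq_b1.
- apply: le_mean => i; rewrite !indicE ler_nat.
  by case: (boolP (_ \in A)) => //; rewrite inE => /AB YB; rewrite mem_set.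
- apply: (weak_law_iid (g := \1_A) law_Ys indep_Ys) => //.
  + by move=> x; rewrite indicE ler0n lern1 leq_b1.
  + rewrite fineK ?fin_num_measure//; last exact: measurable_funPTI.
    rewrite (_ : (fun w => _) = (fun w => (\1_(Y @^-1` A) w)%:E)); last first.
      by apply/funext => w; rewrite !indicE.
    by rewrite integral_indic ?setIT//; exact: measurable_funPTI.
Qed.

(* The least squares criterion at beta0 is uniformly small, hence so is its
   minimum at betahat. *)
Lemma whp_cdf_le_fitted delta : 0 < delta -> whp (fun n => [set w | forall y,
  FY y <= fitted_cdf n w (betahat n w) y + delta]).
Proof.
(* At beta0 the two functions differ by at most 2 r, so the criterion is at most 4 r^2 <= 4 r <=
   delta^3 / 128 < (delta/2)^3 / 8. The remaining delta/2 pays for replacing F_n by F^Y. *)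
move=> delta0; pose r := Num.min (delta / 2) (Num.min 1 (delta ^+ 3 / 512)).
have d30 : 0 < delta ^+ 3 by rewrite exprn_gt0.
have r0 : 0 < r by rewrite !lt_min ltr01/=; apply/andP; split; lra.
have rd : r <= delta / 2 by rewrite ge_min lexx.
have r1 : r <= 1 by rewrite !ge_min lexx !orbT.
have r3 : r <= delta ^+ 3 / 512 by rewrite !ge_min lexx !orbT.
apply: (whp_sub_ge (N := 1)) (whpI betahat_dlse
  (whpI (whp_empirical_cdf r0) (whp_fitted_cdf beta0 r0))) => n n0 w /=.
move=> [dlse [emp fit]] y.
set ys := fun i => Ys i w in dlse emp.
have small : n%:R^-1 * \sum_(j < n) (empirical_cdf n ys (ys j) -
    fitted_cdf n w (betahat n w) (ys j)) ^+ 2 < (delta / 2) ^+ 3 / 8.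
  have := dlse beta0; rewrite !dlse_criterionE// => /le_lt_trans; apply.
  apply: (@le_lt_trans _ _ (mean n (fun=> 4 * r ^+ 2))).
    apply: (@le_mean n (fun j => (empirical_cdf n ys (ys j) -
      fitted_cdf n w beta0 (ys j)) ^+ 2)) => j.
    have -> : 4 * r ^+ 2 = (2 * r) ^+ 2 by ring.
    rewrite -[leLHS]real_normK ?num_real// ler_sqr ?nnegrE ?mulr_ge0 ?(ltW r0)//.
    have := emp (ys j); have := fit (ys j); rewrite -cdf_response.
    by rewrite !ler_norml; lra.
  apply: (le_lt_trans (mean_cst_le _ _)); first by rewrite mulr_ge0// sqr_ge0.
  have rr : r ^+ 2 <= r by rewrite expr2 ler_piMr// ltW.
  have -> : (delta / 2) ^+ 3 / 8 = delta ^+ 3 / 64 by field.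
  lra.
have d20 : 0 < delta / 2 by lra.
have := empirical_cdf_le_of_least_squares n0 (@fitted_cdf_nd n w (betahat n w))
  (fitted_cdf_ge0 n w (betahat n w)) d20 small y.
by have := emp y; rewrite ler_norml; lra.
Qed.

(** Dual to the coordinatewise distance in which nets are measured; see [le_dot_diff]. *)
Definition norm1 (x : 'cV[R]_k) : R := \sum_i `|x i ord0|.

Let measurable_norm1 : measurable_fun [set: 'cV[R]_k] norm1.
Proof.
apply: measurable_sum => i; apply: measurableT_comp => //.
exact: measurable_mx_entry.
Qed.

Let measurable_indicator_gt (f : 'cV[R]_k -> R) (c : R) :
  measurable_fun [set: 'cV[R]_k] f ->
  measurable_fun [set: 'cV[R]_k] (fun x => (c < f x)%R%:R : R).
Proof.
move=> mf; rewrite (_ : (fun x => _) = \1_[set x | c < f x]).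
  exact/measurable_indic/measurable_set_gt.
by apply/funext => x; rewrite indicE mem_setE.
Qed.

Let integral_indicator_gt (f : 'cV[R]_k -> R) (c : R) :
  measurable_fun [set: 'cV[R]_k] f ->
  (\int[P0]_w ((c < f (X w))%R%:R : R)%:E =
   (fine (P0 [set w | c < f (X w)]))%:E)%E.
Proof.
move=> mf; have mfX : measurable_fun setT (fun w => f (X w)).
  exact: measurableT_comp.
have mB := measurable_set_gt c mfX.
rewrite fineK ?fin_num_measure//.
rewrite (_ : (fun w => _) = (fun w => (\1_[set w | c < f (X w)] w)%:E)).
  by rewrite integral_indic ?setIT.
by apply/funext => w; rewrite indicE mem_setE.
Qed.

Lemma whp_norm1_tight delta : 0 < delta -> exists2 K, 0 < K &
  whp (fun n => [set w | mean n (fun i => (K < norm1 (Xs i w))%R%:R) <= delta]).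
Proof.
move=> delta0; have d20 : 0 < delta / 2 by lra.
have mW : measurable_fun setT (fun w => norm1 (X w)) by exact: measurableT_comp.
pose W : {RV P0 >-> R} := mfun_Sub (mem_set mW).
have [L [_ HL]] := cdf_tails W d20.
pose K := Num.max 1 L.
have K0 : 0 < K by rewrite lt_max ltr01.
exists K => //.
have mB := measurable_set_gt K mW.
have PK : fine (P0 [set w | K < norm1 (X w)]) <= delta / 2.
  rewrite -lee_fin fineK ?fin_num_measure//.
  have -> : [set w | K < norm1 (X w)] = ~` (W @^-1` `]-oo, K]).
    apply/seteqP; split=> w /=; rewrite in_itv/= ltNge; first exact/negP.
    by move/negP.
  rewrite probability_setC; last exact: measurable_funPTI.
  have : ((1 - delta / 2)%:E <= cdf W K)%E.
    by apply: (le_trans HL); apply: cdf_nondecreasing; rewrite le_max lexx orbT.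
  rewrite -[P0 _]/(cdf W K) -(fineK (cdf_fin_num W K)) -EFinB !lee_fin; lra.
apply: whp_sub (whp_mean_X (g := fun x => (K < norm1 x)%R%:R)
  (measurable_indicator_gt K measurable_norm1) _
  (integral_indicator_gt K measurable_norm1) d20).
  by move=> n w /=; rewrite ler_norml; lra.
by move=> x; rewrite ler0n lern1 leq_b1.
Qed.

Variable Sigma : 'M[R]_k.
Hypothesis X_normal : multivariate_normal P0 X 0 Sigma.

Let smoothedE b y : smoothed (cdf eps) (qform Sigma b) y =
  (fine (cdf (regression X eps b) y))%:E.
Proof. by rewrite fineK ?cdf_fin_num// (cdf_regression indep_X_eps X_normal). Qed.

(** Since b acts only through [qform Sigma b], this is [smoothed_separation] centred at
    [qform Sigma beta0], whose tail conditions are those of F^Y. *)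
Lemma qform_separation r : 0 < r -> exists eta tau, [/\ 0 < eta, 0 < tau &
  forall b, (forall y, FY y <= fine (cdf (regression X eps b) (y + tau)) + eta) ->
    `|qform Sigma b - qform Sigma beta0| < r].
Proof.
move=> r0.
have sE y : smoothed (cdf eps) (qform Sigma beta0) y = cdf Y y.
  by rewrite smoothedE -cdf_response fineK// cdf_fin_num.
have ctop e : 0 < e -> exists y,
    ((1 - e)%:E <= smoothed (cdf eps) (qform Sigma beta0) y)%E.
  by move=> e0; have [L [_ ?]] := cdf_tails Y e0; exists L; rewrite sE.
have cbot e : 0 < e -> exists y,
    (smoothed (cdf eps) (qform Sigma beta0) y <= e%:E)%E.
  by move=> e0; have [L [? _]] := cdf_tails Y e0; exists (- L); rewrite sE.
have [eta [tau [eta0 tau0 H]]] := smoothed_separation (cdf_ge0 eps)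
  (cdf_le1 eps) (@cdf_nondecreasing _ _ _ _ eps) (cdf_measurable eps)
  (fun e e0 => cdf_tails eps e0) (qform_ge0 X_normal beta0) r0 ctop cbot.
exists eta, tau; split => // b Hb; apply: H; first exact: qform_ge0 X_normal _.
move=> y; rewrite sE smoothedE -(fineK (cdf_fin_num Y y)) -EFinD lee_fin.
exact: Hb.
Qed.

Lemma whp_qform_close M r : 0 <= M -> 0 < r -> whp (fun n => [set w |
  (forall i, `|betahat n w i ord0| <= M) ->
  `|qform Sigma (betahat n w) - qform Sigma beta0| < r]).
Proof.
move=> M0 r0; have r20 : 0 < r / 2 by lra.
have [eta [tau [eta0 tau0 sep]]] := qform_separation r20.
have e30 : 0 < eta / 3 by lra.
have [K K0 tight] := whp_norm1_tight e30.
pose S := \sum_i \sum_j `|Sigma i j|.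
have S0 : 0 <= S by apply: sumr_ge0 => i _; exact: sumr_ge0.
pose D := 2 * M * S + 1.
have D0 : 0 < D by rewrite ltr_wpDl// !mulr_ge0.
(* The first bound keeps the change of b^T X_i within tau when [norm1] of X_i is at most K; the
   second makes the form change by less than r/2, strictly thanks to the 1 in D. *)
pose rho := Num.min (tau / K) (r / 2 / D).
have rho0 : 0 < rho by rewrite lt_min !divr_gt0.
have rhoK : rho * K <= tau by rewrite -ler_pdivlMr// ge_min lexx.
have rhoD : rho * D <= r / 2 by rewrite -ler_pdivlMr// ge_min lexx orbT.
have [I [g [gM net]]] := @box_net R k M rho M0 rho0.
apply: whp_sub (whpI (whp_cdf_le_fitted e30) (whpI tight
  (whp_forall (fun t : I => whp_fitted_cdf (g t) e30)))) => n w /=.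
move=> [le_fit [tightw unif]] bM.
have [t bt] := net _ bM.
have close : `|qform Sigma (betahat n w) - qform Sigma (g t)| < r / 2.
  apply: (le_lt_trans (le_qform_diff Sigma bM (gM t) bt)); rewrite -/S.
  apply: (lt_le_trans _ rhoD); rewrite /D; lra.
have : `|qform Sigma (g t) - qform Sigma beta0| < r / 2.
  apply: sep => y; apply: (le_trans (le_fit y)).
  (* Points with [norm1] at most K are absorbed by the shift tau; each other point costs at most 1,
     and their proportion is at most eta/3. *)
  have h1 : fitted_cdf n w (betahat n w) y <= fitted_cdf n w (g t) (y + tau) +
      mean n (fun i => (K < norm1 (Xs i w))%R%:R).
    rewrite -meanD; apply: le_mean => i.
    have [xK|Kx] := leP (norm1 (Xs i w)) K; last first.
      by rewrite (le_trans (Feps_le1 _))// lerDr Feps_ge0.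
    rewrite addr0; apply: Feps_nd.
    have := le_dot_diff (Xs i w) bt; rewrite -/(norm1 _).
    have : rho * norm1 (Xs i w) <= tau.
      by apply: le_trans rhoK; rewrite ler_pM2l.
    rewrite ler_norml; lra.
  have := unif t (y + tau); rewrite ler_norml; lra.
move: close; rewrite !ltr_norml; lra.
Qed.

Hypothesis k_gt0 : (0 < k)%N.
Hypothesis Sigma_unit : Sigma \in unitmx.

(** If betahat is long, F^eps (y0 - betahat^T X_i) is small for a fixed fraction of the X_i, so the
    fit at y0 stays away from 1, whereas F^Y (y0) is close to 1. Nonsingularity of Sigma bounds the
    variance of u^T X from below over the net points u near a normalized vector. *)
Lemma whp_betahat_bounded : exists2 M, 0 <= M & whp (fun n => [set w |
  forall i, `|betahat n w i ord0| <= M]).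
Proof.
have kR : 0 < k%:R :> R by rewrite ltr0n.
have e_gt0 := @gauss_tail_gt0 R; set e := gauss_tail in e_gt0 *.
have e80 : 0 < e / 8 by lra.
have [SigmaT _ _] := X_normal.
have [C C0 coord] := sqr_coord_le_qform Sigma_unit SigmaT (qform_ge0 X_normal).
have [L [epsL _]] := cdf_tails eps e80.
have [y0 [_ Yy0]] := cdf_tails Y e80.
have {}epsL : Feps (- L) <= e / 8 by rewrite -lee_fin fineK ?cdf_fin_num.
have {}Yy0 : 1 - e / 8 <= FY y0 by rewrite -lee_fin fineK ?cdf_fin_num.
have [K K0 tight] := whp_norm1_tight e80.
(* A vector with [norm1] equal to 1 has a coordinate of size at least 1/k = 2 h, hence at least h at
   a net point within rho <= h. By [sqr_coord_le_qform] that net point has standard deviation at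
   least kap, and so mass at least e beyond kap. *)
pose h := (2 * k%:R : R)^-1.
have h0 : 0 < h by rewrite invr_gt0 mulr_gt0.
pose kap := Num.sqrt (h ^+ 2 / C).
have kap0 : 0 < kap by rewrite sqrtr_gt0 divr_gt0// exprn_gt0.
pose rho := Num.min h (kap / 2 / K).
have rho0 : 0 < rho by rewrite lt_min h0 !divr_gt0.
have rhoh : rho <= h by rewrite ge_min lexx.
have rhoK : rho * K <= kap / 2 by rewrite -ler_pdivlMr// ge_min lexx orbT.
have [I [g [_ net]]] := @box_net R k 1 rho ler01 rho0.
(* Where u^T X_i >= kap/2, a [norm1] above M forces betahat^T X_i >= y0 + L, and F^eps (- L) <= e/8
   applies. *)
pose M := 1 + 2 * `|y0 + L| / kap.
have M0 : 0 < M by rewrite ltr_wpDr// divr_ge0 ?mulr_ge0// ltW.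
have ML : `|y0 + L| <= kap / 2 * M.
  rewrite /M mulrDr mulr1.
  have -> : kap / 2 * (2 * `|y0 + L| / kap) = `|y0 + L| by field; rewrite gt_eqF.
  by rewrite lerDr divr_ge0// ltW.
exists M; first exact: ltW.
have ind01 t x : 0 <= ((kap < dot (g t) x)%R%:R : R) <= 1.
  by rewrite ler0n lern1 leq_b1.
have lln t := whp_mean_X (g := fun x => (kap < dot (g t) x)%R%:R)
  (measurable_indicator_gt kap (measurable_dot (g t)))
  (ind01 t)
  (integral_indicator_gt kap (measurable_dot (g t))) e80.
apply: (whp_sub_ge (N := 1)) (whpI (whp_cdf_le_fitted e80) (whpI tight
  (whp_forall lln))) => n n0 w /=.
move=> [le_fit [tightw llnw]].
set b := betahat n w in le_fit *.
suff bM : norm1 b <= M.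
  by move=> i; apply: le_trans bM; rewrite /norm1 (bigD1 i)//= lerDl sumr_ge0.
rewrite leNgt; apply/negP => Mb.
have a0 : 0 < norm1 b by exact: lt_trans Mb.
pose u := (norm1 b)^-1 *: b.
have uE i : `|u i ord0| = (norm1 b)^-1 * `|b i ord0|.
  by rewrite mxE normrM gtr0_norm// invr_gt0.
have u1 i : `|u i ord0| <= 1.
  rewrite uE ler_pdivrMl// mulr1 /norm1 (bigD1 i)//= lerDl.
  exact: sumr_ge0.
have [t ut] := net u u1.
have [i ui] : exists i, k%:R^-1 <= `|u i ord0|.
  apply: contrapT => /forallNP small.
  have : \sum_i `|u i ord0| < \sum_(i < k) k%:R^-1.
    apply: ltr_sum.
    by apply/hasP; exists (Ordinal k_gt0); rewrite ?mem_index_enum.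
    by move=> i _; rewrite ltNge; apply/negP.
  rewrite sumr_const card_ord -[_ *+ k]mulr_natl mulfV ?gt_eqF//.
  rewrite (eq_bigr _ (fun i _ => uE i)) -mulr_sumr -/(norm1 b).
  by rewrite mulVf ?ltxx// gt_eqF.
have kapq : kap <= Num.sqrt (qform Sigma (g t)).
  rewrite ler_wsqrtr// ler_pdivrMr// mulrC; apply: le_trans (coord (g t) i).
  rewrite -[leRHS]real_normK ?num_real// ler_sqr ?nnegrE ?(ltW h0)//.
  have k2h : k%:R^-1 = 2 * h by rewrite /h; field; rewrite gt_eqF.
  have := lerB_dist (u i ord0) (g t i ord0); have := ut i.
  by rewrite k2h in ui; lra.
have q0 : 0 < qform Sigma (g t) by rewrite -sqrtr_gt0 (lt_le_trans kap0).
have mass : e <= fine (P0 [set w | kap < dot (g t) (X w)]).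
  have mdX : measurable_fun setT (fun w => dot (g t) (X w)).
    exact: (measurableT_comp (measurable_dot (g t))).
  have mB : measurable ((fun w => dot (g t) (X w)) @^-1` `]-oo, kap]).
    by rewrite -[X in measurable X]setTI; exact: mdX.
  have -> : [set w | kap < dot (g t) (X w)] =
      ~` ((fun w => dot (g t) (X w)) @^-1` `]-oo, kap]).
    apply/seteqP; split=> w' /=; rewrite in_itv/= ltNge; first exact/negP.
    by move/negP.
  rewrite probability_setC//.
  have : (P0 ((fun w => dot (g t) (X w)) @^-1` `]-oo, kap]) <= (1 - e)%:E)%E.
    rewrite (dot_normal X_normal)//; apply: le_trans (gaussian_upper_tail q0).
    apply: le_measure; rewrite ?inE//.
    by move=> x /=; rewrite !in_itv/= => /le_trans; apply.
  rewrite -(fineK (fin_num_measure P0 _ mB)) -EFinB/= lee_fin; lra.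
(* Termwise, either the indicator vanishes, or F^eps is at most e/8, or X_i is large. As the
   indicators average at least 7e/8, the fit at y0 is at most 1 - 5e/8, while [le_fit] requires 1 -
   e/4. *)
have h1 : fitted_cdf n w b y0 + mean n (fun i => (kap < dot (g t) (Xs i w))%R%:R) <=
    mean n (fun=> 1 + e / 8) + mean n (fun i => (K < norm1 (Xs i w))%R%:R).
  rewrite -!meanD; apply: le_mean => j; set x := Xs j w.
  have [xK|Kx] := leP (norm1 x) K; last first.
    have := Feps_le1 (y0 - dot b x).
    have : (kap < dot (g t) x)%R%:R <= 1 :> R by rewrite lern1 leq_b1.
    rewrite /=; lra.
  rewrite addr0.
  have [dk|kd] := leP (dot (g t) x) kap.
    by have := Feps_le1 (y0 - dot b x); rewrite /=; lra.
  suff : Feps (y0 - dot b x) <= e / 8 by rewrite /=; lra.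
  apply: le_trans epsL; apply: Feps_nd.
  have dbu : dot b x = norm1 b * dot u x.
    by rewrite /u dotZ mulrA mulfV ?mul1r// gt_eqF.
  have du : kap / 2 <= dot u x.
    have : rho * norm1 x <= kap / 2 by apply: le_trans rhoK; rewrite ler_pM2l.
    by have := le_dot_diff x ut; rewrite -/(norm1 x) ler_norml; lra.
  have : kap / 2 * M <= dot b x.
    rewrite dbu mulrC; apply: ler_pM => //; [exact: ltW|lra|exact: ltW].
  by have := ler_norm (y0 + L); lra.
have h2 : mean n (fun=> 1 + e / 8) <= 1 + e / 8 by apply: mean_cst_le; lra.
by have := le_fit y0; have := llnw t; rewrite ler_norml; lra.
Qed.

End dlse.

(** * Convergence in probability *)

Section stochastic_convergence.
Context {R : realType} {d : measure_display} {T : measurableType d}.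
Variable P : probability T R.
Local Notation whp := (with_probability_tending_to_one P).

Lemma whp_cvg_in_probability (Z : nat -> T -> R) (l : R) :
  (forall n, measurable_fun [set: T] (Z n)) ->
  (forall e, 0 < e -> whp (fun n => [set w | `|Z n w - l| <= e])) ->
  cvg_in_probability P Z l.
Proof.
move=> mZ hZ e e0; apply: whp_cvg0.
  move=> n; apply: measurable_set_gt; apply: measurableT_comp => //.
  exact: measurable_funB.
by apply: whp_sub (hZ e e0) => n w /= le_e; apply/negP; rewrite -leNgt.
Qed.

(** Tightness concerns every n. Beyond some N the hypothesis suffices; each of the finitely many
    earlier Z_n is tight on its own. *)
Lemma whp_bounded_in_probability (Z : nat -> T -> R) (M : R) :
  (forall n, measurable_fun [set: T] (Z n)) ->
  whp (fun n => [set w | `|Z n w| <= M]) -> bounded_in_probability P Z.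
Proof.
move=> mZ hZ e e0.
have mnZ n : measurable_fun [set: T] (fun w => `|Z n w|).
  exact: measurableT_comp.
have mB c n : measurable [set w | c < `|Z n w|] by exact: measurable_set_gt.
have PB : P [set w | M < `|Z n w|] @[n --> \oo] --> 0%E.
  apply: whp_cvg0 => //; apply: whp_sub hZ => n w /= leM.
  by apply/negP; rewrite -leNgt.
have /fine_cvgP[_ /cvgrPdist_le/(_ _ e0)[N _ HN]] := PB.
have tight n : exists L, (P [set w | (L < `|Z n w|)%R] <= e%:E)%E.
  pose W : {RV P >-> R} := mfun_Sub (mem_set (mnZ n)).
  have [L [_ HL]] := cdf_tails W e0; exists L.
  have -> : [set w | (L < `|Z n w|)%R] = ~` (W @^-1` `]-oo, L]).
    apply/seteqP; split=> w /=; rewrite in_itv/= ltNge; first exact/negP.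
    by move/negP.
  rewrite probability_setC; last exact: measurable_funPTI.
  rewrite -[P _]/(cdf W L); move: HL.
  rewrite -(fineK (cdf_fin_num W L)) -EFinB !lee_fin; lra.
pose L n := sval (cid (tight n)).
have LP n : (P [set w | (L n < `|Z n w|)%R] <= e%:E)%E := svalP (cid (tight n)).
(* An upper bound for M and for each L n with n < N. *)
pose M' := M + \sum_(n < N) Num.max 0 (L n - M).
exists M' => n; have [Nn|nN] := leqP N n.
  apply: (@le_trans _ _ (P [set w | (M < `|Z n w|)%R])).
    apply: le_measure; rewrite ?inE// => w /=; apply: le_lt_trans.
    by rewrite lerDl sumr_ge0// => i _; rewrite le_max lexx.
  rewrite -(fineK (fin_num_measure P _ (mB M n))) lee_fin.
  by have := HN n Nn; rewrite /= sub0r normrN; apply: le_trans; exact: ler_norm.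
apply: le_trans (LP n); apply: le_measure; rewrite ?inE// => w /=.
apply: le_lt_trans; rewrite /M' (bigD1 (Ordinal nN))//=.
have h1 : L n - M <= Num.max 0 (L n - M) by rewrite le_max lexx orbT.
have h2 : 0 <= \sum_(i < N | i != Ordinal nN) Num.max 0 (L i - M).
  by apply: sumr_ge0 => i _; rewrite le_max lexx.
lra.
Qed.

(** The square root is Hoelder of exponent 1/2, also across negative arguments, where [Num.sqrt] is
    0. This matters because an estimator of Sigma may fail to be positive semidefinite. *)
Lemma ler_dist_sqrt (a b e : R) : 0 <= e -> `|a - b| <= e ^+ 2 ->
  `|Num.sqrt a - Num.sqrt b| <= e.
Proof.
move=> e0 ab.
have half (x y : R) : y - x <= e ^+ 2 -> Num.sqrt y <= Num.sqrt x + e.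
  move=> yx; have s0 : 0 <= Num.sqrt x + e by rewrite addr_ge0.
  rewrite -[leRHS](ger0_norm s0) -sqrtr_sqr; apply: ler_wsqrtr.
  have xs : x <= Num.sqrt x ^+ 2.
    have [x0|/ltW x0] := leP 0 x; first by rewrite sqr_sqrtr.
    exact: le_trans (sqr_ge0 _).
  have : 0 <= Num.sqrt x * e by rewrite mulr_ge0.
  rewrite sqrrD -mulr_natr; lra.
move: ab; rewrite ler_norml => /andP[ab1 ab2]; rewrite ler_norml.
have := half a b; have := half b a; lra.
Qed.

Lemma measurable_mx_coord m n (Z : {RV P >-> 'M[R]_(m, n)}) i j :
  measurable_fun [set: T] (fun w => Z w i j).
Proof. by apply: (measurableT_comp (measurable_mx_entry i j)). Qed.

Lemma measurable_sqrt_comp (f : T -> R) : measurable_fun [set: T] f ->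
  measurable_fun [set: T] (fun w => Num.sqrt (f w)).
Proof.
move=> mf; apply: measurableT_comp => //.
by apply: continuous_measurable_fun; exact: sqrt_continuous.
Qed.

Lemma measurable_wnorm2 k (S : T -> 'M[R]_k) (b : {RV P >-> 'cV[R]_k}) :
  (forall i j, measurable_fun [set: T] (fun w => S w i j)) ->
  measurable_fun [set: T] (fun w => wnorm2 (S w) (b w)).
Proof.
move=> mS; apply: measurable_sqrt_comp.
rewrite (_ : (fun w => _) =
    fun w => \sum_i \sum_j b w i ord0 * S w i j * b w j ord0).
  apply: measurable_sum => i; apply: measurable_sum => j.
  apply: measurable_funM; last exact: measurable_mx_coord.
  by apply: measurable_funM; [exact: measurable_mx_coord|exact: mS].
by apply/funext => w; rewrite -qformE.
Qed.

Lemma measurable_norm2 k (b : {RV P >-> 'cV[R]_k}) :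
  measurable_fun [set: T] (fun w => norm2 (b w)).
Proof.
apply: measurable_sqrt_comp; apply: measurable_sum => i.
apply: measurable_funX; exact: measurable_mx_coord.
Qed.

Lemma norm2_le k (b : 'cV[R]_k) (M : R) : (forall i, `|b i ord0| <= M) ->
  norm2 b <= Num.sqrt (k%:R * M ^+ 2).
Proof.
move=> bM; apply: ler_wsqrtr.
apply: (@le_trans _ _ (\sum_(i < k) M ^+ 2)); last first.
  by rewrite sumr_const card_ord -[leLHS]mulr_natl.
apply: ler_sum => i _; rewrite -real_normK ?num_real//.
by rewrite ler_sqr ?nnegrE// (le_trans _ (bM i)).
Qed.

Lemma gt_mx_normP k (A : 'M[R]_k) (e : R) : 0 <= e ->
  e < `|A| <-> exists i j, e < `|A i j|.
Proof.
move=> e0; have -> : `|A| = mx_norm A by []; rewrite mx_normrE; split.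
  move=> /bigmax_gtP[|[[i j] _ /= eA]]; first by rewrite ltNge e0.
  by exists i, j.
by move=> [i [j eA]]; apply/bigmax_gtP; right; exists (i, j).
Qed.

(** The matrix norm is the largest entry in absolute value, so the exceptional event is a finite
    union of measurable events, one per entry. *)
Lemma whp_mx_coord k (A : nat -> {RV P >-> 'M[R]_k}) (A0 : 'M[R]_k) (e : R) :
  0 < e -> cvg_in_probability P (fun n w => A n w) A0 ->
  whp (fun n => [set w | forall i j, `|A n w i j - A0 i j| <= e]).
Proof.
move=> e0 cA.
pose B n := [set w | e < `|A n w - A0|].
have mB n : measurable (B n).
  have -> : B n = \big[setU/set0]_(i < k) \big[setU/set0]_(j < k)
      [set w | e < `|A n w i j - A0 i j|].
    apply/seteqP; split=> w.
      move=> /(gt_mx_normP _ (ltW e0))[i [j]]; rewrite !mxE => Aij.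
      by rewrite -bigcup_seq; exists i; [rewrite /= mem_index_enum|
        rewrite -bigcup_seq; exists j; rewrite //= mem_index_enum].
    rewrite -bigcup_seq => -[i _]; rewrite -bigcup_seq => -[j _] /= Aij.
    by apply/(gt_mx_normP _ (ltW e0)); exists i, j; rewrite !mxE.
  apply: bigsetU_measurable => i _; apply: bigsetU_measurable => j _.
  apply: measurable_set_gt; apply: measurableT_comp => //.
  by apply: measurable_funB => //; exact: measurable_mx_coord.
apply: whp_sub (cvg0_whp mB (cA e e0)) => n w /= nB i j.
rewrite leNgt; apply/negP => Aij; apply: nB.
by apply/(gt_mx_normP _ (ltW e0)); exists i, j; rewrite !mxE.
Qed.

End stochastic_convergence.

Theorem proposition4 (R : realType) (d : nat) (hd : (0 < d)%N)
  (disp0 : measure_display) (T0 : measurableType disp0) (P0 : probability T0 R)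
  (X : {RV P0 >-> 'cV[R]_d}) (eps Y : {RV P0 >-> R}) (beta0 : 'cV[R]_d)
  (indep_X_eps : independent_rv P0 X eps)
  (law_Y : same_law P0 P0 Y (fun w => dot beta0 (X w) + eps w))
  (Sigma : 'M[R]_d) (Sigma_nonsingular : Sigma \in unitmx)
  (X_normal : multivariate_normal P0 X 0 Sigma)
  (disp : measure_display) (T : measurableType disp) (P : probability T R)
  (Xs : nat -> {RV P >-> 'cV[R]_d}) (Ys : nat -> {RV P >-> R})
  (law_Xs : forall i, same_law P P0 (Xs i) X)
  (law_Ys : forall i, same_law P P0 (Ys i) Y)
  (indep_samples : mutually_independent P
     (fun i : nat + nat =>
        match i with inl i => sigma_rv (Xs i) | inr j => sigma_rv (Ys j) end))
  (betahat : nat -> {RV P >-> 'cV[R]_d})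
  (betahat_dlse : with_probability_tending_to_one P
     (fun n => [set w | is_dlse (fun y => fine (cdf eps y)) n
                          (fun i => Xs i w) (fun i => Ys i w) (betahat n w)])) :
  bounded_in_probability P (fun n w => norm2 (betahat n w)) /\
  exists c : R,
    [/\ forall beta, model_vectors X eps Y beta -> c = wnorm2 Sigma beta,
        cvg_in_probability P (fun n w => wnorm2 Sigma (betahat n w)) c &
        forall Sigmahat : nat -> {RV P >-> 'M[R]_d},
          cvg_in_probability P (fun n w => Sigmahat n w) Sigma ->
          cvg_in_probability P
            (fun n w => wnorm2 (Sigmahat n w) (betahat n w)) c].
Proof.
have inl_inj : injective (@inl nat nat) by move=> ? ? [].
have inr_inj : injective (@inr nat nat) by move=> ? ? [].
have indep_Xs := mutually_independent_pair inl_inj (fun=> erefl) indep_samples.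
have indep_Ys := mutually_independent_pair inr_inj (fun=> erefl) indep_samples.
have [M M0 bounded] := whp_betahat_bounded indep_X_eps law_Y law_Xs law_Ys
  indep_Xs indep_Ys betahat_dlse X_normal hd Sigma_nonsingular.
have close r : 0 < r -> with_probability_tending_to_one P (fun n => [set w |
    (forall i, `|betahat n w i ord0| <= M) /\
    `|qform Sigma (betahat n w) - qform Sigma beta0| < r]).
  move=> r0; apply: whp_sub (whpI bounded (whp_qform_close indep_X_eps law_Y
    law_Xs law_Ys indep_Xs indep_Ys betahat_dlse X_normal M0 r0)) => n w /=.
  by move=> [bM /(_ bM)].
split.
  apply: (@whp_bounded_in_probability _ _ _ _ _ (Num.sqrt (d%:R * M ^+ 2))).
    by move=> n; exact: measurable_norm2.
  apply: whp_sub bounded => n w /= bM.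
  by rewrite ger0_norm ?sqrtr_ge0//; exact: norm2_le.
exists (wnorm2 Sigma beta0); split.
(* A vector of the model satisfies the premise of [qform_separation] for every r, as its
   distribution function equals F^Y; its form is therefore within every r of that of beta0. *)
- move=> beta model; congr Num.sqrt; apply/esym/eqP.
  rewrite -subr_eq0 -normr_le0; apply/ler_addgt0Pl => r r0; rewrite addr0.
  have [eta [tau [eta0 tau0 sep]]] :=
    qform_separation indep_X_eps law_Y X_normal r0.
  apply/ltW/sep => y.
  have -> : cdf Y y = cdf (regression X eps beta) y.
    rewrite model (convolved_cdfE _ X_normal).
    by rewrite (cdf_regression indep_X_eps X_normal).
  apply: ler_wpDr; first exact: ltW.
  rewrite fine_le ?cdf_fin_num// cdf_nondecreasing// lerDl; exact: ltW.
- apply: whp_cvg_in_probability.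
    by move=> n; apply: measurable_wnorm2 => i j; exact: measurable_cst.
  move=> e e0; have e20 : 0 < e ^+ 2 by rewrite exprn_gt0.
  apply: whp_sub (close _ e20) => n w /= [_ q].
  by apply: ler_dist_sqrt; exact: ltW.
- move=> Sigmahat cSigma; apply: whp_cvg_in_probability.
    by move=> n; apply: measurable_wnorm2 => i j; exact: measurable_mx_coord.
  move=> e e0; have e20 : 0 < e ^+ 2 / 2 by rewrite divr_gt0// exprn_gt0.
  (* D - 1 is the factor by which an entrywise error in Sigmahat is magnified in the form at
     betahat. Half of e^2 goes to this error, half to the form of betahat under Sigma. *)
  pose D := d%:R * d%:R * M * M + 1.
  have D0 : 0 < D by rewrite ltr_wpDl// !mulr_ge0.
  have f0 : 0 < e ^+ 2 / 2 / D by rewrite divr_gt0.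
  apply: whp_sub (whpI (close _ e20) (whp_mx_coord f0 cSigma)) => n w /=.
  move=> [[bM q] SS]; apply: ler_dist_sqrt; first exact: ltW.
  have h := le_qform_diff_mx bM SS.
  have h' : d%:R * (d%:R * (M * (e ^+ 2 / 2 / D) * M)) <= e ^+ 2 / 2.
    have -> : d%:R * (d%:R * (M * (e ^+ 2 / 2 / D) * M)) =
      (D - 1) * (e ^+ 2 / 2 / D) by rewrite /D; ring.
    rewrite mulrBl mul1r mulrCA divff ?gt_eqF// mulr1 lerBlDr lerDl; exact: ltW.
  have := ler_distD (qform Sigma (betahat n w)) (qform (Sigmahat n w) (betahat n w))
    (qform Sigma beta0).
  rewrite -/(qform _ _) -/(qform Sigma beta0); lra.
Qed.
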